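(* For every $\alpha\in\left(\frac12,2\right]$ there is a constant $C_\alpha$ such that for every $T>0$ and every $u_0\in L^4(\Omega;L^2(\mathbb{T}))$ independent of $\{W_t\}_{t>0}$, $$\left\|e^{-iW_t\Delta}u_0\right\|_{L^4(\Omega\times[0,T]\times\mathbb{T})}\le C_\alpha\left(T+T^{1-\frac{\alpha}{2}}\right)^{1/4}\|u_0\|_{L^4(\Omega;L^2(\mathbb{T}))}.$$
   Context: $\mathbb{T}=\mathbb{R}/(2\pi\mathbb{Z})$ and $(W_t)_{t\ge0}$ is a standard real Brownian motion on a probability space $(\Omega,\mathcal{F},\mathbb{P})$. The operator $e^{-iW_t\Delta}$ is the Fourier multiplier on $\mathbb{T}$ with symbol $e^{ik^2W_t}$, $k\in\mathbb{Z}$; i.e. if $u_0=\sum_ka_ke^{ikx}$ then $e^{-iW_t\Delta}u_0=\sum_ka_ke^{i(kx+k^2W_t)}$. *)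

(* Defs.v *)
From HB Require Import structures.
From mathcomp Require Import all_boot all_order all_algebra.
From mathcomp Require Import all_classical all_reals all_analysis.
From mathcomp Require Export complex.

Set Implicit Arguments.
Unset Strict Implicit.
Unset Printing Implicit Defensive.
Import Order.TTheory GRing.Theory Num.Theory.
Import numFieldNormedType.Exports.

Local Open Scope complex_scope.
Local Open Scope classical_set_scope.
Local Open Scope ring_scope.

Section lebesgue_on.
Context {R : realType} (a b : R).

Let mab : measurable (`[a, b] : set (measurableTypeR R)).
Proof. exact: measurable_itv. Qed.

Let fin_ab : (@lebesgue_measure R `[a, b] < +oo)%E.
Proof. by rewrite lebesgue_measure_itv/=; case: ifP => _; rewrite ?ltry ?ltey. Qed.

Definition lebesgue_on : set (measurableTypeR R) -> \bar R := mfrestr mab fin_ab.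

HB.instance Definition _ := FiniteMeasure.on lebesgue_on.

End lebesgue_on.

Section complex_functions.
Context {R : realType}.

Definition cmeasurable d (X : measurableType d) (f : X -> R[i]) : Prop :=
  measurable_fun setT (fun x => complex.Re (f x)) /\
  measurable_fun setT (fun x => complex.Im (f x)).

(* For a complex-valued f, ||f||_{L^p} is the L^p norm of the real function |f|. *)
Definition cLnorm d (X : measurableType d) (mu : {measure set X -> \bar R})
    (p : R) (f : X -> R[i]) : \bar R :=
  Lnorm mu p%:E (fun x => (ComplexField.Normc.normc (f x))%:E).

Definition cintegral d (X : measurableType d) (mu : {measure set X -> \bar R})
    (f : X -> R[i]) : R[i] :=
  (\int[mu]_x complex.Re (f x)) +i* (\int[mu]_x complex.Im (f x)).

Definition expi (x : R) : R[i] := cos x +i* sin x.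

End complex_functions.

Section L2_torus.
Context {R : realType}.

(* Functions on the torus R/(2 pi Z) are 2 pi-periodic functions on R, and
   integration over the torus is (unnormalised) Lebesgue integration over a period. *)
Definition torus_measure : {measure set (measurableTypeR R) -> \bar R} :=
  lebesgue_on 0 (2 * pi).

Definition L2norm (f : measurableTypeR R -> R[i]) : \bar R :=
  cLnorm torus_measure 2 f.

Definition is_L2 (f : measurableTypeR R -> R[i]) : Prop :=
  [/\ forall x : R, f (x + 2 * pi) = f x, cmeasurable f & (L2norm f < +oo)%E].

End L2_torus.

(* Elements are representatives: equality in the space L^2(T) is a.e. equality,
   i.e. L2norm (f - g) = 0. *)
Record L2T (R : realType) := MkL2T {
  L2_fun :> measurableTypeR R -> R[i] ;
  L2_funP : is_L2 L2_fun }.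

Section free_evolution.
Context {R : realType}.

Definition fourier_coef (f : measurableTypeR R -> R[i]) (k : int) : R[i] :=
  ((2 * pi)^-1 +i* 0) *
  cintegral torus_measure (fun x => f x * expi (- (k%:~R * x))).

(* sum over |k| <= N of a_k e^{i(kx + k^2 s)}, a_k the Fourier coefficients of f;
   k = j - N with 0 <= j <= 2N *)
Definition evolution_partial_sum (s : R) (f : measurableTypeR R -> R[i])
    (N : nat) (x : measurableTypeR R) : R[i] :=
  \sum_(j < N.*2.+1)
    let k : int := j%:Z - N%:Z in
    fourier_coef f k * expi (k%:~R * x + (k ^+ 2)%:~R * s).

(* g represents e^{- i s Delta} f : the series
   sum_k a_k e^{i(kx + k^2 s)} converges to g in L^2(T). *)
Definition is_free_evolution (s : R) (f g : measurableTypeR R -> R[i]) : Prop :=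
  is_L2 g /\
  L2norm (fun x => g x - evolution_partial_sum s f N x) @[N --> \oo] --> 0%E.

End free_evolution.

Section L2_random_variables.
Context {R : realType}.

Definition L2_open (U : set (L2T R)) : Prop :=
  forall f : L2T R, U f -> exists2 e : R, 0 < e &
    forall g : L2T R, (L2norm (fun x => (f x - g x)%R) < e%:E)%E -> U g.

(* Open sets do not distinguish a.e.-equal functions, so this is the Borel
   sigma-algebra of the quotient space L^2(T). *)
Definition L2_borel : set (set (L2T R)) := <<s L2_open >>.

Context d (Omega : measurableType d) (P : probability Omega R).

Definition sigma_L2 (u : Omega -> L2T R) : set (set Omega) :=
  preimage_set_system setT u L2_borel.

Definition L4L2norm (u : Omega -> L2T R) : \bar R :=
  Lnorm P 4%:E (fun w => L2norm (u w)).

(* L^4(Omega; L^2(T)); as L^2(T) is separable, Borel measurability is the same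
   as strong measurability. *)
Definition in_L4L2 (u : Omega -> L2T R) : Prop :=
  sigma_L2 u `<=` measurable /\ (L4L2norm u < +oo)%E.

Definition sigma_process (W : R -> Omega -> R) : set (set Omega) :=
  <<s \bigcup_(t in [set t : R | 0 < t])
        preimage_set_system setT (W t : Omega -> measurableTypeR R) measurable >>.

Definition independent_sigma (F G : set (set Omega)) : Prop :=
  forall A B, F A -> G B -> P (A `&` B) = (P A * P B)%E.

(* The values of W at negative times are irrelevant. *)
Record is_brownian (W : R -> Omega -> R) : Prop := {
  brownian_measurable : forall t : R, 0 <= t -> measurable_fun setT (W t) ;
  brownian_start : {ae P, forall w, W 0 w = 0} ;
  brownian_gaussian : forall s t : R, 0 <= s -> s < t ->
    forall B : set (measurableTypeR R), measurable B ->
    P [set w | B (W t w - W s w)] = normal_prob 0 (Num.sqrt (t - s)) B ;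
  brownian_indep : forall (n : nat) (t : nat -> R)
      (B : nat -> set (measurableTypeR R)),
    0 <= t 0%N -> (forall i, (i < n)%N -> t i < t i.+1) ->
    (forall i, measurable (B i)) ->
    P (\big[setI/setT]_(i < n) [set w | B i (W (t i.+1) w - W (t i) w)]) =
    (\prod_(i < n) P [set w | B i (W (t i.+1) w - W (t i) w)%R])%E ;
  brownian_continuous :
    {ae P, forall w, {within `[0, +oo[, continuous (fun t => W t w)}} }.

(* v is a jointly measurable representative, on Omega x [0, tmax] x T, of
   (omega, t) |-> e^{- i W_t(omega) Delta} u(omega). *)
Definition is_random_evolution (W : R -> Omega -> R) (u : Omega -> L2T R)
    (tmax : R) (v : Omega * measurableTypeR R * measurableTypeR R -> R[i]) : Prop :=
  cmeasurable v /\
  {ae (P \x lebesgue_on 0 tmax)%E, forall p,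
    is_free_evolution (W p.2 p.1) (u p.1) (fun x => v (p, x))}.

Definition L4_spacetime_norm (tmax : R)
    (v : Omega * measurableTypeR R * measurableTypeR R -> R[i]) : \bar R :=
  cLnorm ((P \x lebesgue_on 0 tmax) \x lebesgue_on 0 (2 * pi))%E 4 v.

End L2_random_variables.

(* Main.v *)
From HB Require Import structures.
Require Import Defs.
From mathcomp Require Import all_boot all_order all_algebra.
From mathcomp Require Import all_classical all_reals all_analysis.
From mathcomp Require Import measurable_realfun ring lra zify.
Import Order.TTheory GRing.Theory Num.Theory.
Import numFieldNormedType.Exports.
Local Open Scope classical_set_scope.
Local Open Scope ring_scope.
Set Implicit Arguments.
Unset Strict Implicit.
Unset Printing Implicit Defensive.

(** The evolution acts on the Fourier coefficients [a_k] of a datum [f] by phases,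
    so everything is explicit for the truncation [S_N] to the frequencies
    [|k| <= N]. Expanding [|S_N|^4] and integrating over the torus keeps the
    quadruples of frequencies with [k1 - k2 + k3 - k4 = 0]
    ([quartic_mass_partial_sum]), on which the phase factors:
    [k1^2 - k2^2 + k3^2 - k4^2 = 2 (k1 - k2) (k2 - k3)] ([quad_phaseE]).

    Let the phase run along a Brownian path independent of the datum. Averaging
    [expi (m * W_t)] gives the Gaussian damping [exp (- t m^2 / 2)]
    ([expectation_phase]), which is positive, so the coefficients may be replaced
    by their absolute values. The integral of the damping over [[0, T]] is at most
    [T] and at most [2 / m^2], hence at most [T^(1 - alpha/2) (2 / m^2)^(alpha/2)].
    For [m = 2 (k1 - k2) (k2 - k3)] this is bounded by [T^(1 - alpha/2)] times
    [|k1 - k2|^(-2 alpha) + |k2 - k3|^(-2 alpha)], whereas a vanishing gap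
    contributes [T] ([phase_kernel_le_weight]). Since [2 alpha > 1], these weights
    are summable ([sum_weight_le]), and summing them over all additive quadruples
    costs only the square of the sum of the [|a_k|^2]
    ([additive_quadruples_le]), which Bessel's inequality bounds by the norm of
    the datum. This yields a bound for [S_N] that does not depend on [N]
    ([integral_quartic_phase_le]).

    The bound passes to the limit because, for almost every path and time, [S_N]
    tends to the evolution in [L^2] and the fourth power of the [L^4] norm is
    lower semicontinuous for that convergence ([quartic_mass_lsc]); Fatou's lemma
    then exchanges the lower limit with the average.

    The evolution must also be represented by one measurable function of the
    path, the time and the position. Brownian motion is replaced by a jointly
    measurable version of its paths ([brownian_jointly_measurable]). For each
    datum, the truncations are taken along a random subsequence, chosen
    measurably so fast that they converge at almost every position; their
    pointwise upper limit is the representative ([random_evolution_exists]). *)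

Local Notation Re := complex.Re.
Local Notation Im := complex.Im.
Local Notation normc := ComplexField.Normc.normc.
Local Notation normcM := ComplexField.Normc.normcM.

(** * Complex exponentials and their integrals over a period *)

Section complex_facts.
Context {R : realType}.
Local Open Scope complex_scope.
Implicit Types (z w : R[i]) (x y : R).

Lemma sqr_normc z : normc z ^+ 2 = Re z ^+ 2 + Im z ^+ 2.
Proof. by case: z => a b /=; rewrite sqr_sqrtr// addr_ge0// sqr_ge0. Qed.

Lemma normc_ge0 z : 0 <= normc z.
Proof. by case: z => a b; exact: sqrtr_ge0. Qed.

Lemma ReD z w : Re (z + w) = Re z + Re w.
Proof. by case: z => a b; case: w. Qed.

Lemma ImD z w : Im (z + w) = Im z + Im w.
Proof. by case: z => a b; case: w. Qed.

Lemma ReN z : Re (- z) = - Re z. Proof. by case: z. Qed.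

Lemma ImN z : Im (- z) = - Im z. Proof. by case: z. Qed.

Lemma ReM z w : Re (z * w) = Re z * Re w - Im z * Im w.
Proof. by case: z => a b; case: w. Qed.

Lemma ImM z w : Im (z * w) = Re z * Im w + Im z * Re w.
Proof. by case: z => a b; case: w => c d /=; rewrite addrC. Qed.

Lemma Re_sum I (r : seq I) (Q : pred I) (F : I -> R[i]) :
  Re (\sum_(i <- r | Q i) F i) = \sum_(i <- r | Q i) Re (F i).
Proof. exact: (big_morph (@complex.Re R) ReD). Qed.

Lemma complexP z w : Re z = Re w -> Im z = Im w -> z = w.
Proof. by case: z => a b; case: w => c d /= -> ->. Qed.

Lemma ReJ z : Re (conjc z) = Re z. Proof. by case: z. Qed.

Lemma ImJ z : Im (conjc z) = - Im z. Proof. by case: z. Qed.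

Lemma conjcM z w : conjc (z * w) = conjc z * conjc w.
Proof. by apply: complexP; rewrite !(ReJ, ImJ, ReM, ImM); ring. Qed.

Lemma conjc_sum I (r : seq I) (Q : pred I) (F : I -> R[i]) :
  conjc (\sum_(i <- r | Q i) F i) = \sum_(i <- r | Q i) conjc (F i).
Proof.
apply: (big_morph (@conjc R)); last exact: conjc0.
by move=> z w; apply: complexP; rewrite !(ReJ, ImJ, ReD, ImD)// opprD.
Qed.

Lemma Re_mulJ z : Re (z * conjc z) = normc z ^+ 2.
Proof. by rewrite sqr_normc ReM ReJ ImJ mulrN opprK !expr2. Qed.

Lemma normc_conjc z : normc (conjc z) = normc z.
Proof. by case: z => a b /=; rewrite sqrrN. Qed.

Lemma Re_le_normc z : `|Re z| <= normc z.
Proof.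
rewrite -(ler_pXn2r (n := 2))// ?nnegrE ?normr_ge0 ?normc_ge0//.
by rewrite sqr_normc real_normK ?num_real// lerDl sqr_ge0.
Qed.

Lemma Im_le_normc z : `|Im z| <= normc z.
Proof.
rewrite -(ler_pXn2r (n := 2))// ?nnegrE ?normr_ge0 ?normc_ge0//.
by rewrite sqr_normc real_normK ?num_real// lerDr sqr_ge0.
Qed.

Lemma normcN z : normc (- z) = normc z.
Proof. by case: z => a b /=; rewrite !sqrrN. Qed.

Lemma expiD x y : expi (x + y) = expi x * expi y :> R[i].
Proof. by apply: complexP; rewrite ?ReM ?ImM /= ?cosD ?sinD// addrC. Qed.

Lemma conjc_expi x : conjc (expi x) = expi (- x) :> R[i].
Proof. by rewrite /expi /= cosN sinN. Qed.

Lemma expi0 : expi 0 = 1 :> R[i].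
Proof. by rewrite /expi cos0 sin0. Qed.

Lemma normc_expi x : normc (expi x) = 1.
Proof. by rewrite /= cos2Dsin2 sqrtr1. Qed.

End complex_facts.

Section lebesgue_on_facts.
Context {R : realType}.
Variables a b : R.
Local Notation leb := (@lebesgue_measure R).
Local Notation mu := (@lebesgue_on R a b).

Lemma lebesgue_on_setC : mu (~` `[a, b]) = 0%E.
Proof.
by rewrite /lebesgue_on /mfrestr /mrestr setICl measure0.
Qed.

Lemma integral_lebesgue_on_ge0 (f : measurableTypeR R -> \bar R) :
  measurable_fun setT f -> (forall x, 0 <= f x)%E ->
  (\int[mu]_x f x = \int[leb]_(x in `[a, b]) f x)%E.
Proof.
move=> mf f0.
rewrite (@ge0_negligible_integral _ _ _ mu setT (~` `[a, b]))//; last 2 first.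
- exact: measurableC.
- exact: lebesgue_on_setC.
rewrite setTD setCK; apply: eq_measure_integral => A mA Aab.
by rewrite /= /lebesgue_on /mfrestr /mrestr setIidl.
Qed.

Lemma integral_lebesgue_on (f : measurableTypeR R -> \bar R) :
  measurable_fun setT f ->
  (\int[mu]_x f x = \int[leb]_(x in `[a, b]) f x)%E.
Proof.
move=> mf; rewrite integralE [RHS]integralE; congr (_ - _)%E.
- by apply: integral_lebesgue_on_ge0 => //; exact: measurable_funepos.
- by apply: integral_lebesgue_on_ge0 => //; exact: measurable_funeneg.
Qed.

Lemma lebesgue_onT : a <= b -> mu setT = (b - a)%:E.
Proof.
move=> ab; rewrite /lebesgue_on /mfrestr /mrestr setTI /= lebesgue_measure_itv/=.
rewrite lte_fin; case: ltP => // ba; have -> : b = a by apply/le_anti/andP.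
by rewrite subrr.
Qed.

Lemma integrable_on_bounded (f : measurableTypeR R -> R) (M : R) :
  measurable_fun setT f -> (forall x, `|f x| <= M) ->
  mu.-integrable setT (EFin \o f).
Proof.
move=> mf fM; apply: measurable_bounded_integrable => //.
- by rewrite -ge0_fin_numE//; exact: fin_num_measure.
- by exists M; split; [exact: num_real|move=> x Mx y _ /=; rewrite (le_trans (fM y))// ltW].
Qed.

End lebesgue_on_facts.

Section trigonometric_integrals.
Context {R : realType}.
Local Open Scope complex_scope.
Implicit Types (z : R[i]) (k : int).

Lemma sin_2piz k : sin (k%:~R * (2 * pi)) = 0 :> R.
Proof.
have H (n : nat) : sin (n%:R * (2 * pi)) = 0 :> R.
  have := periodicn (@sinD2pi R) n 0.
  by rewrite sin0 add0r -[pi *+ 2]mulr_natl -[X in sin X]mulr_natl.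
by case: k => n; [exact: H|rewrite NegzE mulrNz mulNr sinN H oppr0].
Qed.

Lemma cos_2piz k : cos (k%:~R * (2 * pi)) = 1 :> R.
Proof.
have H (n : nat) : cos (n%:R * (2 * pi)) = 1 :> R.
  have := periodicn (@cosD2pi R) n 0.
  by rewrite cos0 add0r -[pi *+ 2]mulr_natl -[X in cos X]mulr_natl.
by case: k => n; [exact: H|rewrite NegzE mulrNz mulNr cosN H].
Qed.

Lemma expi_2piz k : expi (k%:~R * (2 * pi)) = 1 :> R[i].
Proof. by rewrite /expi cos_2piz sin_2piz. Qed.

Lemma measurable_Re_expi d (X : measurableType d) (f : X -> R) :
  measurable_fun [set: X] f -> measurable_fun [set: X] (fun x => Re (expi (f x))).
Proof.
by apply: (@measurableT_comp _ _ _ _ _ _ (@cos R)); apply: continuous_measurable_fun; exact: continuous_cos.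
Qed.

Lemma measurable_Im_expi d (X : measurableType d) (f : X -> R) :
  measurable_fun [set: X] f -> measurable_fun [set: X] (fun x => Im (expi (f x))).
Proof.
by apply: (@measurableT_comp _ _ _ _ _ _ (@sin R)); apply: continuous_measurable_fun; exact: continuous_sin.
Qed.

Lemma Re_expi_le z x : `|Re (z * expi x)| <= normc z.
Proof. by rewrite (le_trans (Re_le_normc _))// normcM normc_expi mulr1. Qed.

Lemma measurable_Re_mul_expi z k :
  measurable_fun setT (fun x : measurableTypeR R => Re (z * expi (k%:~R * x))).
Proof.
under eq_fun do rewrite ReM.
apply: measurable_funB; apply: measurable_funM => //.
- by apply: measurable_Re_expi; exact: measurable_funM.
- by apply: measurable_Im_expi; exact: measurable_funM.
Qed.

Lemma integrable_Re_expi z k :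
  torus_measure.-integrable setT (fun x : measurableTypeR R => (Re (z * expi (k%:~R * x)))%:E).
Proof.
apply: (@integrable_on_bounded _ _ _ (fun x => Re (z * expi (k%:~R * x))) (normc z)).
- exact: measurable_Re_mul_expi.
- by move=> x; exact: Re_expi_le.
Qed.

Lemma integral_Re_expi z k :
  (\int[torus_measure]_x (Re (z * expi (k%:~R * x)))%:E)%E =
  (if k == 0 then 2 * pi * Re z else 0)%:E.
Proof.
have pi2 : 0 < 2 * pi :> R by rewrite mulr_gt0// pi_gt0.
case: ifPn => [/eqP ->|k0].
  under eq_integral do rewrite mul0r expi0 mulr1.
  rewrite integral_cst//= (@lebesgue_onT _ 0 (2*pi)) ?ltW// subr0.
  by rewrite -EFinM mulrC.
rewrite integral_lebesgue_on; last by apply/measurable_EFinP; exact: measurable_Re_mul_expi.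
pose K : R := k%:~R.
have K0 : K != 0 by rewrite intr_eq0.
pose F (x : R) := K^-1 * (Re z * sin (K * x) + Im z * cos (K * x)).
have dF (x : R) : is_derive x 1 F (Re (z * expi (K * x))).
  rewrite /F ReM /=.
  by apply: is_derive_eq; rewrite !scaler1 /GRing.scale /=; field.
have cf : continuous (fun x : R => Re (z * expi (K * x))).
  rewrite (_ : (fun x => _) = fun x => Re z * cos (K * x) - Im z * sin (K * x)).
    by move=> x; apply/differentiable_continuous/derivable1_diffP; exact: ex_derive.
  by apply/funext => x; rewrite ReM.
have cF : continuous F.
  by move=> x; apply/differentiable_continuous/derivable1_diffP; exact: (@ex_derive _ _ _ _ _ _ _ (dF x)).
rewrite (@continuous_FTC2 _ _ F)//; last 3 first.
- exact: continuous_subspaceT.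
- split.
  + by move=> x _; exact: (@ex_derive _ _ _ _ _ _ _ (dF x)).
  + by apply: cvg_at_right_filter; exact: cF.
  + by apply: cvg_at_left_filter; exact: cF.
- by move=> x _; rewrite derive1E (@derive_val _ _ _ _ _ _ _ (dF x)).
by rewrite -EFinB /F /K /= cos_2piz sin_2piz !mulr0 cos0 sin0 mulr0 subrr.
Qed.

End trigonometric_integrals.

(** * Trigonometric polynomials, Fourier coefficients and Bessel's inequality *)

Section complex_measurability.
Context d (X : measurableType d) {R : realType}.
Implicit Types f g : X -> R[i]%C.

Lemma cmeasurableD f g : cmeasurable f -> cmeasurable g ->
  cmeasurable (fun x => f x + g x).
Proof.
move=> [f1 f2] [g1 g2]; split.
- by under eq_fun do rewrite ReD; exact: measurable_funD.
- by under eq_fun do rewrite ImD; exact: measurable_funD.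
Qed.

Lemma cmeasurableN f : cmeasurable f -> cmeasurable (fun x => - f x).
Proof.
move=> [f1 f2]; split.
- by under eq_fun do rewrite ReN; exact: measurable_funN.
- by under eq_fun do rewrite ImN; exact: measurable_funN.
Qed.

Lemma cmeasurableB f g : cmeasurable f -> cmeasurable g ->
  cmeasurable (fun x => f x - g x).
Proof. by move=> mf mg; exact: (cmeasurableD mf (cmeasurableN mg)). Qed.

Lemma cmeasurableM f g : cmeasurable f -> cmeasurable g ->
  cmeasurable (fun x => f x * g x).
Proof.
move=> [f1 f2] [g1 g2]; split.
- under eq_fun do rewrite ReM.
  by apply: measurable_funB; exact: measurable_funM.
- under eq_fun do rewrite ImM.
  by apply: measurable_funD; exact: measurable_funM.
Qed.

Lemma cmeasurable_conjc f : cmeasurable f -> cmeasurable (fun x => conjc (f x)).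
Proof.
move=> [f1 f2]; split.
- by under eq_fun do rewrite ReJ.
- by under eq_fun do rewrite ImJ; exact: measurable_funN.
Qed.

Lemma cmeasurable_cst (z : R[i]%C) : cmeasurable (fun _ : X => z).
Proof. by split; exact: measurable_cst. Qed.

Lemma cmeasurable_sum I (r : seq I) (Q : pred I) (F : I -> X -> R[i]%C) :
  (forall i, cmeasurable (F i)) ->
  cmeasurable (fun x => \sum_(i <- r | Q i) F i x).
Proof.
move=> mF; elim: r => [|i r IH].
  by under eq_fun do rewrite big_nil; exact: cmeasurable_cst.
under eq_fun do rewrite big_cons.
by case: (Q i) => //; exact: cmeasurableD.
Qed.

Lemma cmeasurable_expi (h : X -> R) :
  measurable_fun [set: X] h -> cmeasurable (fun x => expi (h x)).
Proof. by move=> mh; split; [exact: measurable_Re_expi|exact: measurable_Im_expi]. Qed.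

Lemma measurable_normc f : cmeasurable f ->
  measurable_fun [set: X] (fun x => normc (f x)).
Proof.
move=> [f1 f2].
rewrite (_ : (fun x => _) = fun x => Num.sqrt (Re (f x) ^+ 2 + Im (f x) ^+ 2)).
  apply: (@measurableT_comp _ _ _ _ _ _ (@Num.sqrt R)).
    by apply: continuous_measurable_fun; exact: sqrt_continuous.
  by apply: measurable_funD; exact: measurable_funX.
by apply/funext => x; case: (f x).
Qed.

End complex_measurability.

Section trigonometric_polynomials.
Context {R : realType}.
Local Open Scope complex_scope.
Local Notation mu := (@torus_measure R).

Lemma integral_trig (I : finType) (z : I -> R[i]) (n : I -> int) :
  (\int[mu]_x (Re (\sum_i z i * expi ((n i)%:~R * x)))%:E)%E =
  (2 * pi * \sum_(i | n i == 0) Re (z i))%:E.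
Proof.
under eq_integral do rewrite Re_sum -sumEFin.
rewrite integral_sum//; last by move=> i; exact: integrable_Re_expi.
under eq_bigr do rewrite integral_Re_expi.
by rewrite sumEFin mulr_sumr [in RHS]big_mkcond.
Qed.

Definition trig_poly (I : finType) (c : I -> R[i]) (n : I -> int)
  (x : measurableTypeR R) : R[i] := \sum_i c i * expi ((n i)%:~R * x).

Lemma cmeasurable_trig_poly (I : finType) (c : I -> R[i]) (n : I -> int) :
  cmeasurable (trig_poly c n).
Proof.
apply: cmeasurable_sum => i; apply: cmeasurableM; first exact: cmeasurable_cst.
by apply: cmeasurable_expi; exact: measurable_funM.
Qed.

Lemma trig_polyM (I J : finType) (c : I -> R[i]) (n : I -> int)
    (e : J -> R[i]) (m : J -> int) x :
  trig_poly c n x * trig_poly e m x =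
  trig_poly (fun p : I * J => c p.1 * e p.2) (fun p => n p.1 + m p.2) x.
Proof.
rewrite /trig_poly mulr_suml.
under eq_bigr do rewrite mulr_sumr.
rewrite pair_bigA; apply: eq_bigr => -[i j] _ /=.
by rewrite intrD mulrDl expiD; ring.
Qed.

Lemma conjc_trig_poly (I : finType) (c : I -> R[i]) (n : I -> int) x :
  conjc (trig_poly c n x) = trig_poly (fun i => conjc (c i)) (fun i => - n i) x.
Proof.
rewrite /trig_poly conjc_sum; apply: eq_bigr => i _.
by rewrite conjcM conjc_expi intrN mulNr.
Qed.

Lemma sqr_normc_trig_poly (I : finType) (c : I -> R[i]) (n : I -> int) x :
  normc (trig_poly c n x) ^+ 2 =
  Re (trig_poly (fun p : I * I => c p.1 * conjc (c p.2)) (fun p => n p.1 - n p.2) x).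
Proof. by rewrite -Re_mulJ conjc_trig_poly trig_polyM. Qed.

Lemma Re_sqr_mulJ (z : R[i]) : Re ((z * conjc z) * (z * conjc z)) = normc z ^+ 4.
Proof.
rewrite (_ : z * conjc z = (normc z ^+ 2)%:C); first by rewrite /=; ring.
apply: complexP; first by rewrite Re_mulJ.
by rewrite ImM ReJ ImJ /=; ring.
Qed.

Lemma pow4_normc_trig_poly (I : finType) (c : I -> R[i]) (n : I -> int) x :
  normc (trig_poly c n x) ^+ 4 =
  Re (trig_poly
    (fun q : (I * I) * (I * I) =>
       (c q.1.1 * conjc (c q.1.2)) * (c q.2.1 * conjc (c q.2.2)))
    (fun q => (n q.1.1 - n q.1.2) + (n q.2.1 - n q.2.2)) x).
Proof. by rewrite -Re_sqr_mulJ conjc_trig_poly !trig_polyM. Qed.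

End trigonometric_polynomials.

Section cLnorm_nat.
Context d (X : measurableType d) {R : realType}.
Variable mu : {measure set X -> \bar R}.
Local Open Scope ereal_scope.

Lemma cLnorm_nat (n : nat) (f : X -> R[i]%C) :
  cLnorm mu n%:R f = (\int[mu]_x ((normc (f x) ^+ n)%R)%:E) `^ (n%:R)^-1.
Proof.
rewrite /cLnorm unlock; congr (_ `^ _); apply: eq_integral => x _.
by rewrite abse_EFin poweR_EFin ger0_norm ?normc_ge0// powR_mulrn ?normc_ge0.
Qed.

End cLnorm_nat.

Section square_integrable.
Context {R : realType}.
Local Open Scope complex_scope.
Local Notation mu := (@torus_measure R).
Implicit Types f g : measurableTypeR R -> R[i].

Definition sqr_mass f : \bar R := (\int[mu]_x (normc (f x) ^+ 2)%:E)%E.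

Lemma sqr_mass_ge0 f : (0 <= sqr_mass f)%E.
Proof. by apply: integral_ge0 => x _; rewrite lee_fin sqr_ge0. Qed.

Lemma L2norm_sqr_mass f : L2norm f = (sqr_mass f `^ 2^-1)%E.
Proof. exact: (cLnorm_nat mu 2). Qed.

Lemma sqr_massE f : (sqr_mass f = L2norm f `^ 2)%E.
Proof.
by rewrite L2norm_sqr_mass -poweRrM mulVf// poweRe1// sqr_mass_ge0.
Qed.

Definition square_integrable f := cmeasurable f /\ (sqr_mass f < +oo)%E.

Lemma is_L2_square_integrable f : is_L2 f -> square_integrable f.
Proof.
move=> [_ mf foo]; split => //.
by rewrite sqr_massE poweR_lty.
Qed.

Lemma integrable_sqr_normc f : square_integrable f ->
  mu.-integrable setT (fun x => (normc (f x) ^+ 2)%:E).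
Proof.
move=> [mf foo]; apply/integrableP; split.
  by apply/measurable_EFinP; apply: measurable_funX; exact: measurable_normc.
by under eq_integral do rewrite abse_EFin ger0_norm ?sqr_ge0//.
Qed.

Lemma integrable_normc f : square_integrable f ->
  mu.-integrable setT (fun x => (normc (f x))%:E).
Proof.
move=> fL2; have [mf foo] := fL2.
apply: (@le_integrable _ _ _ _ _ _ _ (fun x => (normc (f x) ^+ 2 + 1)%:E)) => //.
- by apply/measurable_EFinP; exact: measurable_normc.
- move=> x _; rewrite lee_fin !ger0_norm ?normc_ge0 ?addr_ge0 ?sqr_ge0//.
  by have := sqr_ge0 (normc (f x) - 1); have := sqr_ge0 (normc (f x)); lra.
- under eq_fun do rewrite EFinD.
  apply: integrableD => //; first exact: integrable_sqr_normc.
  exact: finite_measure_integrable_cst.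
Qed.

Lemma integrable_Re_mul f g : square_integrable f -> cmeasurable g ->
  (exists M, forall x, normc (g x) <= M) ->
  mu.-integrable setT (fun x => (Re (f x * g x))%:E).
Proof.
move=> fL2 mg [M gM]; have [mf _] := fL2.
apply: (@le_integrable _ _ _ _ _ _ _ (fun x => (M * normc (f x))%:E)) => //.
- by apply/measurable_EFinP; have [] := cmeasurableM mf mg.
- move=> x _; rewrite lee_fin (le_trans (Re_le_normc _))// normcM.
  have M0 : 0 <= M by rewrite (le_trans _ (gM x))// normc_ge0.
  by rewrite ger0_norm ?mulr_ge0 ?normc_ge0// mulrC ler_wpM2r ?normc_ge0.
- under eq_fun do rewrite EFinM.
  by apply: integrableZl => //; exact: integrable_normc.
Qed.

Lemma normc_trig_poly_le (I : finType) (c : I -> R[i]) (n : I -> int) x :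
  normc (trig_poly c n x) <= \sum_i normc (c i).
Proof.
rewrite /trig_poly; elim/big_rec2: _ => [|i y z _ IH].
  by rewrite ComplexField.Normc.normc0.
rewrite (le_trans (le_normcD _ _))// lerD//.
by rewrite normcM normc_expi mulr1.
Qed.

Lemma square_integrable_trig_poly (I : finType) (c : I -> R[i]) (n : I -> int) :
  square_integrable (trig_poly c n).
Proof.
split; first exact: cmeasurable_trig_poly.
rewrite /sqr_mass; under eq_integral do rewrite sqr_normc_trig_poly.
by rewrite integral_trig ltry.
Qed.

Lemma sqr_mass_trig_poly (I : finType) (c : I -> R[i]) (n : I -> int) :
  injective n -> sqr_mass (trig_poly c n) = (2 * pi * \sum_i normc (c i) ^+ 2)%:E.
Proof.
move=> ninj; rewrite /sqr_mass; under eq_integral do rewrite sqr_normc_trig_poly.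
rewrite integral_trig; congr (_ * _)%:E.
rewrite (eq_bigl (fun p : I * I => p.2 == p.1)); last first.
  by move=> -[i j] /=; rewrite subr_eq0 (inj_eq ninj) eq_sym.
rewrite -(pair_big_dep predT (fun i j => j == i) (fun i j => Re (c i * conjc (c j))))/=.
by apply: eq_bigr => i _; rewrite big_pred1_eq Re_mulJ.
Qed.

Lemma sqr_massBC f g :
  sqr_mass (fun x => f x - g x) = sqr_mass (fun x => g x - f x).
Proof. by apply: eq_integral => x _; rewrite -normcN opprB. Qed.

Lemma square_integrableN f : square_integrable f ->
  square_integrable (fun x => - f x).
Proof.
move=> [mf foo]; split; first exact: cmeasurableN.
by rewrite /sqr_mass; under eq_integral do rewrite normcN.
Qed.

Lemma sqr_normcD_le (z w : R[i]) :
  normc (z + w) ^+ 2 <= 2 * normc z ^+ 2 + 2 * normc w ^+ 2.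
Proof.
have h := le_normcD z w; have := normc_ge0 (z + w).
have := sqr_ge0 (normc z - normc w); nra.
Qed.

Lemma sqr_massD_le f g : cmeasurable f -> cmeasurable g ->
  (sqr_mass (fun x => f x + g x)%R <= 2%:E * sqr_mass f + 2%:E * sqr_mass g)%E.
Proof.
move=> mf mg.
have m2 h : cmeasurable h -> measurable_fun setT (fun x : measurableTypeR R => (normc (h x) ^+ 2)%:E).
  by move=> mh; apply/measurable_EFinP; apply: measurable_funX; exact: measurable_normc.
rewrite -!ge0_integralZl//; try exact: m2; try by move=> x _; rewrite lee_fin sqr_ge0.
rewrite -ge0_integralD//; last 4 first.
- by move=> x _; rewrite mule_ge0// lee_fin sqr_ge0.
- by apply: measurable_funeM; exact: m2.
- by move=> x _; rewrite mule_ge0// lee_fin sqr_ge0.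
- by apply: measurable_funeM; exact: m2.
apply: ge0_le_integral => //.
- by move=> x _; rewrite lee_fin sqr_ge0.
- by apply: m2; exact: cmeasurableD.
- by apply: emeasurable_funD; apply: measurable_funeM; exact: m2.
- by move=> x _; rewrite -!EFinM -EFinD lee_fin sqr_normcD_le.
Qed.

Lemma square_integrableD f g : square_integrable f -> square_integrable g ->
  square_integrable (fun x => f x + g x).
Proof.
move=> [mf foo] [mg goo]; split; first exact: cmeasurableD.
rewrite (le_lt_trans (sqr_massD_le mf mg))//.
by rewrite lte_add_pinfty// lte_mul_pinfty.
Qed.

Lemma square_integrableB f g : square_integrable f -> square_integrable g ->
  square_integrable (fun x => f x - g x).
Proof. by move=> fL2 gL2; exact: (square_integrableD fL2 (square_integrableN gL2)). Qed.

End square_integrable.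

Section integrable_real.
Context d (X : measurableType d) {R : realType}.
Variable m : {measure set X -> \bar R}.
Implicit Types f g : X -> R.

Lemma integrableD_EFin f g : m.-integrable setT (fun x => (f x)%:E) ->
  m.-integrable setT (fun x => (g x)%:E) ->
  m.-integrable setT (fun x => (f x + g x)%:E).
Proof.
by move=> mf mg; under eq_fun do rewrite EFinD; exact: integrableD.
Qed.

Lemma integrableB_EFin f g : m.-integrable setT (fun x => (f x)%:E) ->
  m.-integrable setT (fun x => (g x)%:E) ->
  m.-integrable setT (fun x => (f x - g x)%:E).
Proof.
by move=> mf mg; under eq_fun do rewrite EFinB; exact: integrableB.
Qed.

Lemma integrableZl_EFin (k : R) f : m.-integrable setT (fun x => (f x)%:E) ->
  m.-integrable setT (fun x => (k * f x)%:E).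
Proof.
by move=> mf; under eq_fun do rewrite EFinM; exact: integrableZl.
Qed.

Lemma dominated_integrable_EFin f g : measurable_fun [set: X] f ->
  (forall x, `|f x| <= g x) -> m.-integrable setT (fun x => (g x)%:E) ->
  m.-integrable setT (fun x => (f x)%:E).
Proof.
move=> mf fg; apply: le_integrable => //; first exact/measurable_EFinP.
by move=> x _; rewrite lee_fin (le_trans (fg x))// ler_norm.
Qed.

Lemma Rintegral_sum_EFin (I : finType) (Q : pred I) (F : I -> X -> R) :
  (forall i, m.-integrable setT (EFin \o F i)) ->
  \int[m]_x (\sum_(i | Q i) F i x) = \sum_(i | Q i) \int[m]_x (F i x).
Proof.
move=> iF; rewrite /Rintegral.
under eq_integral do rewrite -sumEFin.
rewrite integral_sum//= -sum_fine// => i _.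
exact: integrable_fin_num (iF i).
Qed.

End integrable_real.

Section fourier_coefficients.
Context {R : realType}.
Local Open Scope complex_scope.
Local Notation mu := (@torus_measure R).
Implicit Types f g : measurableTypeR R -> R[i].

Let pi2_gt0 : 0 < 2 * pi :> R.
Proof. by rewrite mulr_gt0// pi_gt0. Qed.

Lemma cmeasurable_expiN (k : int) :
  cmeasurable (fun x : measurableTypeR R => expi (- (k%:~R * x))).
Proof.
by apply: cmeasurable_expi; apply: measurable_funN; exact: measurable_funM.
Qed.

Lemma integrable_Re_fourier f k : square_integrable f ->
  mu.-integrable setT (fun x => (Re (f x * expi (- (k%:~R * x))))%:E).
Proof.
move=> fL2; apply: integrable_Re_mul => //; first exact: cmeasurable_expiN.
by exists 1 => x; rewrite normc_expi.
Qed.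

(** The imaginary part is the real part after multiplication by [-i]. *)
Lemma integrable_Im_fourier f k : square_integrable f ->
  mu.-integrable setT (fun x => (Im (f x * expi (- (k%:~R * x))))%:E).
Proof.
move=> fL2.
rewrite (_ : (fun x => _) =
    fun x => (Re (f x * ((0 +i* (-1)) * expi (- (k%:~R * x)))))%:E); last first.
  by apply/funext => x; rewrite !(ReM, ImM) /=; congr EFin; ring.
apply: integrable_Re_mul => //.
  by apply: cmeasurableM; [exact: cmeasurable_cst|exact: cmeasurable_expiN].
by exists 1 => x; rewrite normcM normc_expi /= expr0n/= add0r sqrrN expr1n sqrtr1 mulr1.
Qed.

Lemma Re_fourier_coef f k : Re (fourier_coef f k) =
  (2 * pi)^-1 * \int[mu]_x (Re (f x * expi (- (k%:~R * x)))).
Proof. by rewrite /fourier_coef ReM /= mul0r subr0. Qed.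

Lemma Im_fourier_coef f k : Im (fourier_coef f k) =
  (2 * pi)^-1 * \int[mu]_x (Im (f x * expi (- (k%:~R * x)))).
Proof. by rewrite /fourier_coef ImM /= mul0r addr0. Qed.

Lemma fourier_coefB f g k : square_integrable f -> square_integrable g ->
  fourier_coef (fun x => f x - g x) k = fourier_coef f k - fourier_coef g k.
Proof.
move=> fL2 gL2; apply: complexP.
- rewrite ReD ReN !Re_fourier_coef -mulrBr -RintegralB//; last 2 first.
  + exact: integrable_Re_fourier.
  + exact: integrable_Re_fourier.
  by congr (_ * _); apply: eq_Rintegral => x _; rewrite mulrBl ReD ReN.
- rewrite ImD ImN !Im_fourier_coef -mulrBr -RintegralB//; last 2 first.
  + exact: integrable_Im_fourier.
  + exact: integrable_Im_fourier.
  by congr (_ * _); apply: eq_Rintegral => x _; rewrite mulrBl ImD ImN.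
Qed.

Lemma integrable_inner_expi f (w : R[i]) k : square_integrable f ->
  mu.-integrable setT (fun x => (Re (f x * conjc (w * expi (k%:~R * x))))%:E).
Proof.
move=> fL2; apply: integrable_Re_mul => //.
- apply: cmeasurable_conjc; apply: cmeasurableM; first exact: cmeasurable_cst.
  by apply: cmeasurable_expi; exact: measurable_funM.
- by exists (normc w) => x; rewrite normc_conjc normcM normc_expi mulr1.
Qed.

Lemma inner_expi f (w : R[i]) k : square_integrable f ->
  \int[mu]_x (Re (f x * conjc (w * expi (k%:~R * x)))) =
  2 * pi * Re (fourier_coef f k * conjc w).
Proof.
move=> fL2.
transitivity (\int[mu]_x (Re w * Re (f x * expi (- (k%:~R * x))) +
                          Im w * Im (f x * expi (- (k%:~R * x))))).
  apply: eq_Rintegral => x _.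
  by rewrite conjcM conjc_expi !(ReM, ImM, ReJ, ImJ); ring.
rewrite RintegralD//; last 2 first.
- apply: integrableZl_EFin.
  exact: integrable_Re_fourier.
- apply: integrableZl_EFin.
  exact: integrable_Im_fourier.
rewrite !RintegralZl//; [|exact: integrable_Im_fourier|exact: integrable_Re_fourier].
rewrite ReM ReJ ImJ Re_fourier_coef Im_fourier_coef.
by move: pi2_gt0; move: (2 * pi) => T T0; field; rewrite gt_eqF.
Qed.

(** Bessel's inequality follows from the positivity of the mass of the
    difference between [f] and the corresponding Fourier sum. *)
Lemma bessel (I : finType) (n : I -> int) f : injective n -> square_integrable f ->
  ((2 * pi * \sum_i normc (fourier_coef f (n i)) ^+ 2)%:E <= sqr_mass f)%E.
Proof.
move=> ninj fL2; pose p := trig_poly (fun i => fourier_coef f (n i)) n.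
set S := \sum_i _.
have pL2 : square_integrable p by exact: square_integrable_trig_poly.
have fp : mu.-integrable setT (fun x => (Re (f x * conjc (p x)))%:E).
  apply: integrable_Re_mul => //.
    by apply: cmeasurable_conjc; exact: cmeasurable_trig_poly.
  by exists (\sum_i normc (fourier_coef f (n i))) => x; rewrite normc_conjc normc_trig_poly_le.
have Ifp : \int[mu]_x (Re (f x * conjc (p x))) = 2 * pi * S.
  under eq_Rintegral do rewrite /p /trig_poly conjc_sum mulr_sumr Re_sum.
  rewrite Rintegral_sum_EFin; last by move=> i; exact: integrable_inner_expi.
  rewrite mulr_sumr; apply: eq_bigr => i _.
  by rewrite inner_expi// Re_mulJ.
have Ip : \int[mu]_x (normc (p x) ^+ 2) = 2 * pi * S.
  by rewrite /Rintegral -/(sqr_mass p) sqr_mass_trig_poly.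
have sf := integrable_sqr_normc fL2; have sp := integrable_sqr_normc pL2.
have If : sqr_mass f = (\int[mu]_x (normc (f x) ^+ 2))%:E.
  by rewrite /Rintegral fineK//; apply: integrable_fin_num.
rewrite If lee_fin -subr_ge0.
rewrite (_ : _ - _ = \int[mu]_x (normc (f x - p x) ^+ 2)).
  by apply: Rintegral_ge0 => x _; exact: sqr_ge0.
transitivity (\int[mu]_x (normc (f x) ^+ 2 + normc (p x) ^+ 2 - 2 * Re (f x * conjc (p x)))).
  rewrite RintegralB//; last 2 first.
  - exact: integrableD_EFin.
  - exact: integrableZl_EFin.
  by rewrite RintegralD// RintegralZl// Ifp Ip; ring.
apply: eq_Rintegral => x _.
by rewrite !sqr_normc !(ReD, ImD, ReN, ImN, ReM, ReJ, ImJ); ring.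
Qed.

Lemma normc_fourier_coef_le f k : square_integrable f ->
  ((2 * pi * normc (fourier_coef f k) ^+ 2)%:E <= sqr_mass f)%E.
Proof.
move=> fL2.
have ninj : injective (fun _ : unit => k) by case; case.
by have := bessel ninj fL2; rewrite (big_pred1 tt)//; case.
Qed.

End fourier_coefficients.

(** * Gaussian averages of the Brownian phase *)

Section normal_characteristic_function.
Context {R : realType}.
Variable sigma : R.
Hypothesis sigma_gt0 : 0 < sigma.
Local Notation leb := (@lebesgue_measure R).

Let phi := normal_pdf 0 sigma.
Let V : R := sigma ^+ 2.

Let V_gt0 : 0 < V. Proof. by rewrite exprn_gt0. Qed.

Let V_neq0 : V != 0. Proof. by rewrite gt_eqF. Qed.

Let phiE x : phi x = normal_peak sigma * expR (- (2 * V)^-1 * x ^+ 2).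
Proof.
rewrite /phi normal_pdfE ?gt_eqF// /normal_fun subr0; congr (_ * expR _).
by rewrite -/V -mulr_natl; field; rewrite V_neq0.
Qed.

Let phi_ge0 x : 0 <= phi x. Proof. exact: normal_pdf_ge0. Qed.

Let phi_derive (x : R) : is_derive x 1 phi (- V^-1 * x * phi x).
Proof.
rewrite (_ : phi = fun x => normal_peak sigma * expR (- (2 * V)^-1 * x ^+ 2)).
  by apply: is_derive_eq; rewrite /GRing.scale /=; field.
by apply/funext => y; exact: phiE.
Qed.

Let measurable_phi : measurable_fun [set: R] phi.
Proof. exact: measurable_normal_pdf. Qed.

(** A Gaussian of twice the variance dominates the first moment. *)
Let integrable_moment : leb.-integrable [set: R] (fun x => (`|x| * phi x)%:E).
Proof.
pose s2 := Num.sqrt 2 * sigma.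
have s2_gt0 : 0 < s2 by rewrite mulr_gt0// sqrtr_gt0.
have s2E : s2 ^+ 2 = 2 * V by rewrite exprMn sqr_sqrtr.
pose k := (2 * V + 1) * (normal_peak sigma / normal_peak s2).
have pk0 := normal_peak_gt0 (lt0r_neq0 s2_gt0).
have pk1 := normal_peak_gt0 (lt0r_neq0 sigma_gt0).
have bnd (x : R) : `|x| * phi x <= k * normal_pdf 0 s2 x.
  rewrite phiE normal_pdfE ?gt_eqF// /normal_fun subr0 /k.
  set A := normal_peak sigma; set B := normal_peak s2.
  have -> : (2 * V + 1) * (A / B) * (B * expR (- x ^+ 2 / (s2 ^+ 2 *+ 2))) =
            A * ((2 * V + 1) * expR (- (4 * V)^-1 * x ^+ 2)).
    rewrite (_ : - x ^+ 2 / (s2 ^+ 2 *+ 2) = - (4 * V)^-1 * x ^+ 2).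
      by field; rewrite gt_eqF.
    by rewrite s2E -mulr_natl; field; rewrite V_neq0.
  rewrite mulrCA; apply: ler_wpM2l; first exact: ltW.
  rewrite [- (4 * V)^-1 * _]mulNr.
  rewrite (_ : - (2 * V)^-1 * x ^+ 2 = - ((4 * V)^-1 * x ^+ 2) - (4 * V)^-1 * x ^+ 2); last by field.
  rewrite expRD [leLHS]mulrA ler_pM2r ?expR_gt0//.
  rewrite expRN ler_pdivrMr ?expR_gt0//.
  have y0 : 0 <= (4 * V)^-1 * x ^+ 2 by rewrite mulr_ge0 ?sqr_ge0// invr_ge0 mulr_ge0// ltW.
  have := expR_ge1Dx ((4 * V)^-1 * x ^+ 2).
  set E := expR _ => hE.
  have hx : `|x| <= (2 * V + 1) * (1 + (4 * V)^-1 * x ^+ 2).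
    rewrite -(real_normK (num_real x)).
    have -> : (2 * V + 1) * (1 + (4 * V)^-1 * `|x| ^+ 2) =
      2 * V + 1 + 2^-1 * `|x| ^+ 2 + (4 * V)^-1 * `|x| ^+ 2 by field.
    have := sqr_ge0 (`|x| - 1).
    have : 0 <= (4 * V)^-1 * `|x| ^+ 2 by rewrite mulr_ge0 ?sqr_ge0// invr_ge0 mulr_ge0// ltW.
    by have := V_gt0; lra.
  by rewrite (le_trans hx)// ler_wpM2l// addr_ge0// mulr_ge0// ltW.
apply: (@dominated_integrable_EFin _ _ _ leb (fun x : R => `|x| * phi x) (fun x : R => k * normal_pdf 0 s2 x)).
- by apply: measurable_funM => //; exact: measurableT_comp.
- by move=> x; rewrite (ger0_norm (mulr_ge0 (normr_ge0 _) (phi_ge0 _))); exact: bnd.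
- by under eq_fun do rewrite EFinM; apply: integrableZl => //; exact: integrable_normal_pdf.
Qed.

(** Decay at infinity, from [1 + y <= exp y]. *)
Let phi_bound (x : R) : x != 0 -> phi x <= normal_peak sigma * (2 * V) * `|x| ^- 2.
Proof.
move=> x0; rewrite phiE -mulrA; apply: ler_wpM2l; first exact: normal_peak_ge0.
have x2 : 0 < `|x| ^+ 2 by rewrite exprn_gt0// normr_gt0.
rewrite -(real_normK (num_real x)) mulNr expRN ler_pdivlMr//.
rewrite mulrC ler_pdivrMr ?expR_gt0//.
have := expR_ge1Dx ((2 * V)^-1 * `|x| ^+ 2).
set E := expR _ => hE.
rewrite -[leLHS](mulVKf (mulf_neq0 (lt0r_neq0 (ltr0Sn R 1)) V_neq0)).
by apply: ler_wpM2l; [rewrite mulr_ge0// ltW|lra].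
Qed.

Let integrable_trig_phi (f : R -> R) : measurable_fun [set: R] f ->
  (forall x, `|f x| <= 1) -> leb.-integrable [set: R] (fun x => (f x * phi x)%:E).
Proof.
move=> mf f1.
apply: (@dominated_integrable_EFin _ _ _ leb (fun x : R => f x * phi x) phi).
- exact: measurable_funM.
- by move=> x; rewrite normrM (ger0_norm (phi_ge0 x)) ler_piMl.
- exact: integrable_normal_pdf.
Qed.

Let integrable_trig_moment (f : R -> R) : measurable_fun [set: R] f ->
  (forall x, `|f x| <= 1) -> leb.-integrable [set: R] (fun x => (x * f x * phi x)%:E).
Proof.
move=> mf f1.
apply: (@dominated_integrable_EFin _ _ _ leb (fun x : R => x * f x * phi x) (fun x : R => `|x| * phi x)).
- by apply: measurable_funM => //; exact: measurable_funM.
- move=> x; rewrite normrM (ger0_norm (phi_ge0 x)).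
  by rewrite ler_wpM2r// normrM ler_piMr.
- exact: integrable_moment.
Qed.

Variable theta : R.
Let F (s : R) := \int[leb]_x (cos (s * x + theta) * phi x).

Let measurable_affine_cos (s : R) : measurable_fun [set: R] (fun x => cos (s * x + theta)).
Proof.
apply: (measurable_Re_expi (f := fun x : R => s * x + theta)).
by apply: measurable_funD => //; exact: measurable_funM.
Qed.

Let measurable_affine_sin (s : R) : measurable_fun [set: R] (fun x => sin (s * x + theta)).
Proof.
apply: (measurable_Im_expi (f := fun x : R => s * x + theta)).
by apply: measurable_funD => //; exact: measurable_funM.
Qed.

(** Differentiation under the integral sign, dominated by the first moment. *)
Let F_derive (s : R) :
  is_derive s 1 F (- \int[leb]_x (x * sin (s * x + theta) * phi x)).
Proof.
pose f (s x : R) := cos (s * x + theta) * phi x.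
have df (s' x : R) : is_derive s' 1 (f ^~ x) (- (x * sin (s' * x + theta) * phi x)).
  by rewrite /f; apply: is_derive_eq; rewrite /GRing.scale /=; ring.
have d1f (s' x : R) : partial1of2 f s' x = - (x * sin (s' * x + theta) * phi x).
  by rewrite partial1of2E (@derive_val _ _ _ _ _ _ _ (df s' x)).
have Is : s \in `]s - 1, s + 1[ by rewrite in_itv/=; apply/andP; split; lra.
have If (s' : R) : `]s - 1, s + 1[%classic s' -> leb.-integrable setT (EFin \o f s').
  by move=> _; apply: integrable_trig_phi => // x; exact: cos_max.
have Df (s' x : R) : `]s - 1, s + 1[%classic s' -> setT x -> derivable (f ^~ x) s' 1.
  by move=> _ _; exact: (@ex_derive _ _ _ _ _ _ _ (df s' x)).
have G0 (x : R) : 0 <= `|x| * phi x by rewrite mulr_ge0.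
have Gub (s' x : R) : `]s - 1, s + 1[%classic s' -> setT x ->
    `|partial1of2 f s' x| <= `|x| * phi x.
  move=> _ _; rewrite d1f normrN normrM (ger0_norm (phi_ge0 x)) ler_wpM2r//.
  by rewrite normrM ler_piMr// sin_max.
have D := derivable_under_integral measurableT Is If Df G0 integrable_moment Gub.
have E := differentiation_under_integral measurableT Is If Df G0 integrable_moment Gub.
apply: DeriveDef; first exact: D.
rewrite -derive1E E.
under eq_Rintegral do rewrite d1f.
under eq_Rintegral do rewrite -mulN1r.
rewrite RintegralZl ?mulN1r//.
by apply: integrable_trig_moment => // x; exact: sin_max.
Qed.

Let dphi_sin (s x : R) : R :=
  s * (cos (s * x + theta) * phi x) - V^-1 * (x * sin (s * x + theta) * phi x).

Let integrable_dphi_sin (s : R) : leb.-integrable [set: R] (fun x => (dphi_sin s x)%:E).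
Proof.
apply: integrableB_EFin; apply: integrableZl_EFin.
- by apply: integrable_trig_phi => // x; exact: cos_max.
- by apply: integrable_trig_moment => // x; exact: sin_max.
Qed.

(** This integrand is the derivative of [sin (s x + theta) * phi x], which
    vanishes at both infinities. *)
Let integral_dphi_sin (s : R) : \int[leb]_x (dphi_sin s x) = 0.
Proof.
pose H (x : R) := sin (s * x + theta) * phi x.
have dH (x : R) : is_derive x 1 H (dphi_sin s x).
  have ? := phi_derive x.
  by rewrite /H; apply: is_derive_eq; rewrite /dphi_sin /GRing.scale /=; field.
have cphi (x : R) : {for x, continuous phi}.
  by apply/differentiable_continuous/derivable1_diffP; exact: (@ex_derive _ _ _ _ _ _ _ (phi_derive x)).
have cH (x : R) : {for x, continuous H}.
  by apply/differentiable_continuous/derivable1_diffP; exact: (@ex_derive _ _ _ _ _ _ _ (dH x)).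
have cosc (x : R) : {for x, continuous (fun x : R => cos (s * x + theta))}.
  by apply/differentiable_continuous/derivable1_diffP; exact: ex_derive.
have sinc (x : R) : {for x, continuous (fun x : R => x * sin (s * x + theta))}.
  by apply/differentiable_continuous/derivable1_diffP; exact: ex_derive.
have cdH : continuous (dphi_sin s).
  move=> x; apply: cvgB.
    by apply: cvgM; [exact: cvg_cst|apply: cvgM; [exact: cosc|exact: cphi]].
  by apply: cvgM; [exact: cvg_cst|apply: cvgM; [exact: sinc|exact: cphi]].
pose h (n : nat) (x : R) := dphi_sin s x * \1_(`[- n.+1%:R, n.+1%:R]) x.
have mdH : measurable_fun [set: R] (dphi_sin s).
  by have /measurable_EFinP := measurable_int _ (integrable_dphi_sin s).
have mh n : measurable_fun [set: R] (fun x => (h n x)%:E).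
  by apply/measurable_EFinP; apply: measurable_funM => //; exact: measurable_indic.
have hle n x : `|h n x| <= `|dphi_sin s x|.
  by rewrite normrM ler_piMr// indicE; case: (_ \in _); rewrite ?normr1 ?normr0.
have hcvg x : (h n x)%:E @[n --> \oo] --> (dphi_sin s x)%:E.
  apply: cvg_near_cst; near=> n.
  rewrite /h indicE mem_set ?mulr1//=.
  rewrite in_itv/= -ler_norml (le_trans (ltW (truncnS_gt `|x|)))// ler_nat ltnS.
  by near: n; exact: nbhs_infty_ge.
have [_ _ cv] : [/\ leb.-integrable [set: R] (fun x => (dphi_sin s x)%:E),
    (\int[leb]_x `|(h n x)%:E - (dphi_sin s x)%:E|)%E @[n --> \oo] --> 0%E &
    (\int[leb]_x (h n x)%:E)%E @[n --> \oo] --> (\int[leb]_x (dphi_sin s x)%:E)%E].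
  apply: (@dominated_convergence _ _ _ leb [set: R] measurableT
    (fun n x => (h n x)%:E) (fun x => (dphi_sin s x)%:E) (fun x => `|(dphi_sin s x)%:E|%E)) => //.
  - exact: measurable_int (integrable_dphi_sin s).
  - by apply: aeW => x _; exact: hcvg.
  - exact: integrable_abse (integrable_dphi_sin s).
  - by apply: aeW => x n _; rewrite lee_fin.
have inth n : (\int[leb]_x (h n x)%:E)%E = (H n.+1%:R - H (- n.+1%:R))%:E.
  rewrite EFinB -(@continuous_FTC2 _ (dphi_sin s) H (- n.+1%:R) n.+1%:R)//; last 4 first.
  - by rewrite -subr_gt0 opprK -natrD ltr0n.
  - exact: continuous_subspaceT.
  - split.
    + by move=> x _; exact: (@ex_derive _ _ _ _ _ _ _ (dH x)).
    + by apply: cvg_at_right_filter; exact: cH.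
    + by apply: cvg_at_left_filter; exact: cH.
  - by move=> x _; rewrite derive1E (@derive_val _ _ _ _ _ _ _ (dH x)).
  rewrite [RHS]integral_mkcond; apply: eq_integral => x _.
  by rewrite /h patchE indicE; case: (_ \in _); rewrite ?mulr1 ?mulr0.
move: cv; under eq_fun do rewrite inth.
move=> cv; rewrite /Rintegral -(cvg_lim _ cv)//.
rewrite (_ : (fun n => _) = EFin \o (fun n => H n.+1%:R - H (- n.+1%:R)))//.
suff Hcv : (fun n => H n.+1%:R - H (- n.+1%:R)) @ \oo --> (0 : R).
  by rewrite (cvg_lim (@ereal_hausdorff R) (cvg_EFin _ Hcv))//; near=> n.
pose K := 2 * (normal_peak sigma * (2 * V)).
apply/norm_cvg0P.
apply: (@squeeze_cvgr _ _ _ _ (cst 0) (fun n => K * harmonic n)).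
- near=> n; rewrite normr_ge0 /=.
  have Hle (x : R) : 1 <= `|x| -> `|H x| <= normal_peak sigma * (2 * V) * `|x|^-1.
    move=> x1.
    have x0 : 0 < `|x| by rewrite (lt_le_trans _ x1).
    rewrite normrM (ger0_norm (phi_ge0 x)) (@le_trans _ _ (phi x))//.
      by rewrite ler_piMl// sin_max.
    rewrite (le_trans (phi_bound _)) -?normr_gt0//.
    apply: ler_wpM2l; first by rewrite mulr_ge0 ?normal_peak_ge0// mulr_ge0// ltW.
    by rewrite lef_pV2 ?posrE ?exprn_gt0// ler_eXnr.
  have n1 : 1 <= `|n.+1%:R| :> R by rewrite ger0_norm// ler1n.
  rewrite (le_trans (ler_normB _ _))// /K /harmonic /=.
  have := Hle _ n1; have := Hle (- n.+1%:R); rewrite normrN => /(_ n1).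
  rewrite (ger0_norm (ler0n _ _)) -(mulrA 2).
  by set Y := _ / _ => h1 h2; lra.
- exact: cvg_cst.
- by rewrite -[0](mulr0 K); apply: cvgM; [exact: cvg_cst|exact: cvg_harmonic].
Unshelve. all: end_near. Qed.

(** The integral [F] solves [F' s = - V s F s]: its derivative is turned into a
    multiple of [F] by an integration by parts based on [phi' x = - x phi x / V].
    The shift [theta] covers the cosine and the sine at once. *)
Lemma Rintegral_cos_normal_pdf (s : R) :
  \int[leb]_x (cos (s * x + theta) * phi x) = cos theta * expR (- (V * s ^+ 2) / 2).
Proof.
have dF (t : R) : is_derive t 1 F (- (V * t) * F t).
  apply: (is_derive_eq (F_derive t)).
  have := integral_dphi_sin t; rewrite RintegralB//; last 2 first.
  - by apply: integrableZl_EFin; apply: integrable_trig_phi => // x; exact: cos_max.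
  - by apply: integrableZl_EFin; apply: integrable_trig_moment => // x; exact: sin_max.
  rewrite !RintegralZl//; last 2 first.
  - by apply: integrable_trig_moment => // x; exact: sin_max.
  - by apply: integrable_trig_phi => // x; exact: cos_max.
  rewrite -/(F t) => /eqP; rewrite subr_eq0 => /eqP E.
  by rewrite mulNr -mulrA E mulrA mulfV// mul1r.
pose G (t : R) := F t * expR (V * t ^+ 2 / 2).
have dG (t : R) : is_derive t 1 G 0.
  have ? := dF t.
  by rewrite /G; apply: is_derive_eq; rewrite /GRing.scale /=; field.
have GE : G s = G 0 by apply: is_derive_0_is_cst.
have F0 : F 0 = cos theta.
  rewrite /F; under eq_Rintegral do rewrite mul0r add0r.
  rewrite RintegralZl//; last exact: integrable_normal_pdf.
  by rewrite /Rintegral integral_normal_pdf mulr1.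
move: GE; rewrite /G F0 expr0n mulr0 mul0r expR0 mulr1 -/(F s) => <-.
by rewrite -[RHS]mulrA -expRD mulNr subrr expR0 mulr1.
Qed.

End normal_characteristic_function.

Section normal_expectation.
Context {R : realType}.
Local Notation leb := (@lebesgue_measure R).

(** The density is almost everywhere the Radon-Nikodym derivative, for which
    the change of variables is known. *)
Lemma integral_normal_prob (m s : R) (f : measurableTypeR R -> \bar R) :
  measurable_fun [set: measurableTypeR R] f ->
  (normal_prob m s).-integrable [set: measurableTypeR R] f ->
  (\int[normal_prob m s]_x f x = \int[leb]_x (f x * (normal_pdf m s x)%:E))%E.
Proof.
move=> mf intf.
have dom := normal_prob_dominates m s.
rewrite -(Radon_Nikodym_change_of_variables dom measurableT intf).
have mpdf : measurable_fun [set: measurableTypeR R] (fun x => (normal_pdf m s x)%:E).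
  by apply/measurable_EFinP; exact: measurable_normal_pdf.
apply: ae_eq_integral => //.
- exact: emeasurable_funM.
- exact: emeasurable_funM.
- apply: ae_eqe_mul2l => /=.
  apply: integral_ae_eq => //; first by apply: Radon_Nikodym_integrable.
  by move=> E _ mE; rewrite -Radon_Nikodym_integral.
Qed.

End normal_expectation.

Section product_expectation.
Context d (Omega : measurableType d) {R : realType} (P : probability Omega R).
Variables X Y : Omega -> R.
Hypotheses (mX : measurable_fun [set: Omega] X) (mY : measurable_fun [set: Omega] Y).
Hypothesis indepXY : forall A B : set R, measurable A -> measurable B ->
  P (X @^-1` A `&` Y @^-1` B) = (P (X @^-1` A) * P (Y @^-1` B))%E.

Let Xm : {mfun Omega >-> R} := mfun_Sub (mem_set mX).
Let Ym : {mfun Omega >-> R} := mfun_Sub (mem_set mY).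
Let mXY : measurable_fun [set: Omega] (fun w => (X w, Y w)).
Proof. exact: measurable_fun_pair. Qed.
Let XYm : {mfun Omega >-> (R * R)%type} := mfun_Sub (mem_set mXY).

(** Independence says that the joint law is a product measure, so the
    expectation of the product is computed by Fubini's theorem. *)
Lemma expectation_prod_indep (M : R) :
  P.-integrable setT (EFin \o X) -> (forall w, `|Y w| <= M) ->
  \int[P]_w (X w * Y w) = (\int[P]_w X w) * (\int[P]_w Y w).
Proof.
move=> iX YM.
have iY : P.-integrable setT (EFin \o Y).
  apply: (@dominated_integrable_EFin _ _ _ P Y (cst M)) => //.
  exact: finite_measure_integrable_cst.
have mM : measurable_fun [set: (R * R)%type] (fun z : R * R => z.1 * z.2).
  by apply: measurable_funM.
have iXY : P.-integrable setT (fun w => (X w * Y w)%:E).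
  apply: (@dominated_integrable_EFin _ _ _ P _ (fun w => M * `|X w|)).
  - exact: measurable_funM.
  - by move=> w; rewrite normrM mulrC ler_wpM2r.
  - by apply: integrableZl_EFin; exact: integrable_norm.
pose mu1 : probability R R := distribution P Xm.
pose mu2 : probability R R := distribution P Ym.
have prodE A : measurable A -> (mu1 \x mu2)%E A = distribution P XYm A.
  apply: product_measure_unique => {}A B mA mB.
  exact: indepXY.
have E1 : (\int[P]_w (X w * Y w)%:E = \int[distribution P XYm]_z (z.1 * z.2)%:E)%E.
  rewrite (@integral_distribution _ _ _ _ _ P XYm (fun z => (z.1 * z.2)%:E))//.
  exact/measurable_EFinP.
have iprod : (mu1 \x mu2)%E.-integrable [set: (R * R)%type] (fun z => (z.1 * z.2)%:E).
  apply/integrableP; split; first exact/measurable_EFinP.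
  rewrite (@eq_measure_integral _ _ _ setT (distribution P XYm)); last first.
    by move=> A mA _; exact: prodE.
  rewrite (@ge0_integral_distribution _ _ _ _ _ P XYm (fun z => `|(z.1 * z.2)%:E|)%E)//.
    by have /integrableP[] := iXY.
  by apply: measurableT_comp => //; exact/measurable_EFinP.
have eX : (\int[mu1]_x x%:E = \int[P]_w (X w)%:E)%E.
  by rewrite (@integral_distribution _ _ _ _ _ P Xm (fun x => x%:E))//; exact: EFin_measurable.
have eY : (\int[mu2]_x x%:E = \int[P]_w (Y w)%:E)%E.
  by rewrite (@integral_distribution _ _ _ _ _ P Ym (fun x => x%:E))//; exact: EFin_measurable.
have imu1 : mu1.-integrable setT (EFin : R -> \bar R).
  apply/integrableP; split => //.
  rewrite (@ge0_integral_distribution _ _ _ _ _ P Xm (fun z => `|z%:E|)%E)//; last first.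
    by apply: measurableT_comp => //; exact: EFin_measurable.
  by have /integrableP[] := iX.
have imu2 : mu2.-integrable setT (EFin : R -> \bar R).
  apply/integrableP; split => //.
  rewrite (@ge0_integral_distribution _ _ _ _ _ P Ym (fun z => `|z%:E|)%E)//; last first.
    by apply: measurableT_comp => //; exact: EFin_measurable.
  by have /integrableP[] := iY.
rewrite /Rintegral E1 -(@eq_measure_integral _ _ _ setT (distribution P XYm) (mu1 \x mu2)%E); last first.
  by move=> A mA _; exact: prodE.
rewrite -(integral12_prod_meas1 iprod) /fubini_F /=.
under eq_integral do under eq_integral do rewrite EFinM.
under eq_integral do rewrite integralZl//.
have fY : (\int[mu2]_x x%:E)%E \is a fin_num by exact: integrable_fin_num imu2.
rewrite -(fineK fY) integralZr// eX eY fineM//.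
by rewrite -eX; exact: integrable_fin_num imu1.
Qed.

End product_expectation.

Section brownian_phase.
Context d (Omega : measurableType d) {R : realType} (P : probability Omega R).
Variable W : R -> Omega -> R.
Hypothesis BM : is_brownian P W.

Let mW (t : R) : 0 <= t -> measurable_fun [set: Omega] (W t).
Proof. by move=> t0; exact: brownian_measurable BM _ t0. Qed.

Let measurable_cos_affine (l theta : R) :
  measurable_fun [set: R] (fun x : R => cos (l * x + theta)).
Proof.
apply: (measurable_Re_expi (f := fun x : R => l * x + theta)).
by apply: measurable_funD => //; exact: measurable_funM.
Qed.

(** The increment from time 0, where the path almost surely vanishes, has the
    normal law. *)
Lemma expectation_cos_brownian (t l theta : R) : 0 < t ->
  \int[P]_w cos (l * W t w + theta) = cos theta * expR (- (t * l ^+ 2) / 2).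
Proof.
move=> t0; pose s := Num.sqrt t.
have s0 : 0 < s by rewrite sqrtr_gt0.
have s2 : s ^+ 2 = t by rewrite sqr_sqrtr// ltW.
pose D : Omega -> measurableTypeR R := fun w => W t w - W 0 w.
have mD : measurable_fun [set: Omega] D.
  by apply: measurable_funB; apply: mW => //; exact: ltW.
pose Dm : {mfun Omega >-> measurableTypeR R} := mfun_Sub (mem_set mD).
pose f (x : R) := cos (l * x + theta).
have mf : measurable_fun [set: R] f by exact: measurable_cos_affine.
have law A : measurable A -> distribution P Dm A = normal_prob 0 s A.
  move=> mA; rewrite /s -[X in Num.sqrt X]subr0.
  by rewrite -(brownian_gaussian BM (lexx 0) t0 mA).
have ifn : (normal_prob 0 s).-integrable [set: measurableTypeR R] (fun x => (f x)%:E).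
  apply: (@dominated_integrable_EFin _ (measurableTypeR R) _ (normal_prob 0 s) f (cst 1)) => //.
  - by move=> x; exact: cos_max.
  - exact: finite_measure_integrable_cst.
have ifD : P.-integrable [set: Omega] (fun w => (f (D w))%:E).
  apply: (@dominated_integrable_EFin _ _ _ P (f \o D) (cst 1)) => //.
  - exact: measurableT_comp.
  - by move=> x; exact: cos_max.
  - exact: finite_measure_integrable_cst.
rewrite -[in RHS]s2 -(Rintegral_cos_normal_pdf s0) /Rintegral; congr fine.
transitivity (\int[P]_w (f (D w))%:E)%E.
  apply: ae_eq_integral => //.
  - apply/measurable_EFinP; apply: (@measurableT_comp _ _ _ _ _ _ f) => //.
    by apply: mW; exact: ltW.
  - exact: measurable_int ifD.
  - apply: filterS (brownian_start BM) => w W0 _.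
    by rewrite /f /D W0 subr0.
under [RHS]eq_integral do rewrite EFinM.
rewrite -(@integral_normal_prob R 0 s (fun x => (f x)%:E))//; last exact/measurable_EFinP.
rewrite -(@integral_distribution _ _ _ _ _ P Dm (fun x => (f x)%:E))//; last exact/measurable_EFinP.
by apply: eq_measure_integral => A mA _; exact: law.
Qed.

(** The real and imaginary parts of the amplitude are each independent of the
    path, so the expectations factor; by symmetry the sine averages to zero. *)
Lemma expectation_phase (F : set (set Omega)) (z : Omega -> R[i]%C) (t l : R) : 0 < t ->
  independent_sigma P F (sigma_process W) ->
  cmeasurable z ->
  (forall A : set R, measurable A -> F ((fun w => Re (z w)) @^-1` A)) ->
  (forall A : set R, measurable A -> F ((fun w => Im (z w)) @^-1` A)) ->
  P.-integrable setT (fun w => (normc (z w))%:E) ->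
  \int[P]_w (Re (z w * expi (l * W t w))) =
  expR (- (t * l ^+ 2) / 2) * \int[P]_w (Re (z w)).
Proof.
move=> t0 indep [mR mI] FR FI iz.
have iR : P.-integrable setT (fun w => (Re (z w))%:E).
  by apply: (@dominated_integrable_EFin _ _ _ P _ (fun w => normc (z w))) => // w; exact: Re_le_normc.
have iI : P.-integrable setT (fun w => (Im (z w))%:E).
  by apply: (@dominated_integrable_EFin _ _ _ P _ (fun w => normc (z w))) => // w; exact: Im_le_normc.
have mWt : measurable_fun [set: Omega] (W t) by apply: mW; exact: ltW.
have mcos theta : measurable_fun [set: Omega] (fun w => cos (l * W t w + theta)).
  by apply: (@measurableT_comp _ _ _ _ _ _ (fun x : R => cos (l * x + theta))).
have proc theta (B : set R) : measurable B ->
    sigma_process W ((fun w => cos (l * W t w + theta)) @^-1` B).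
  move=> mB; apply: sub_sigma_algebra; exists t => //=.
  exists ((fun x : R => cos (l * x + theta)) @^-1` B); last by rewrite setTI.
  by rewrite -[X in measurable X]setTI; exact: measurable_cos_affine.
have key (X : Omega -> R) theta : measurable_fun [set: Omega] X ->
    (forall A : set R, measurable A -> F (X @^-1` A)) ->
    P.-integrable setT (fun w => (X w)%:E) ->
    \int[P]_w (X w * cos (l * W t w + theta)) =
    (\int[P]_w X w) * (cos theta * expR (- (t * l ^+ 2) / 2)).
  move=> mX FX iX; rewrite -(expectation_cos_brownian _ _ t0).
  apply: (@expectation_prod_indep _ _ _ P X (fun w => cos (l * W t w + theta)) _ _ _ 1) => //.
  - by move=> A B mA mB; apply: indep; [exact: FX|exact: proc].
  - by move=> w; exact: cos_max.
(* The sine is a shifted cosine, so that one averaging formula serves twice. *)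
transitivity (\int[P]_w (Re (z w) * cos (l * W t w + 0) -
                        Im (z w) * cos (l * W t w + - (pi / 2)))).
  by apply: eq_Rintegral => w _; rewrite ReM addr0 cosBpihalf.
have iprod (X : Omega -> R) theta : measurable_fun [set: Omega] X ->
    P.-integrable setT (fun w => (X w)%:E) ->
    P.-integrable setT (fun w => (X w * cos (l * W t w + theta))%:E).
  move=> mX iX; apply: (@dominated_integrable_EFin _ _ _ P _ (fun w => `|X w|)).
  - exact: measurable_funM.
  - by move=> w; rewrite normrM ler_piMr// cos_max.
  - exact: integrable_norm.
rewrite RintegralB//; last 2 first.
- exact: iprod.
- exact: iprod.
rewrite !key// cos0 cosN cos_pihalf mul0r mulr0 subr0 mul1r.
by rewrite mulrC.
Qed.

End brownian_phase.

(** * Borel measurable functionals of the datum *)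

Lemma le_poweR {R : realType} (x y : \bar R) (r : R) : 0 <= r ->
  (0 <= x)%E -> (x <= y)%E -> (x `^ r <= y `^ r)%E.
Proof.
move=> r0 x0 xy; apply: gt0_ler_poweR => //; rewrite in_itv/= leey andbT//.
exact: le_trans xy.
Qed.

Section L2_space_pointed.
Context {R : realType}.

Lemma is_L2_zero : @is_L2 R (fun=> 0).
Proof.
split=> //.
rewrite L2norm_sqr_mass poweR_lty// /sqr_mass.
under eq_integral do rewrite ComplexField.Normc.normc0 expr0n.
by rewrite integral0 ltry.
Qed.

End L2_space_pointed.

(** The sigma-algebra generated by the open sets is formed over a pointed
    carrier. *)
HB.instance Definition _ (R : realType) := gen_eqMixin (L2T R).
HB.instance Definition _ (R : realType) := gen_choiceMixin (L2T R).
HB.instance Definition _ (R : realType) := isPointed.Build (L2T R) (MkL2T is_L2_zero).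

Section L2_functionals.
Context {R : realType}.
Local Notation L2B := (g_sigma_algebraType (@L2_open R)).
Implicit Types f g : L2T R.

(** The preimage of an open half-line is open for the [L^2] distance. *)
Lemma lipschitz_measurable (phi : L2T R -> R) :
  (forall f g (r : R), (L2norm (fun x => f x - g x)%R < r%:E)%E ->
    `|phi f - phi g| <= r) ->
  measurable_fun [set: L2B] phi.
Proof.
move=> lip.
apply: (measurability _ (RGenOInfty.measurableE R)) => // _ [_ [r ->] <-].
rewrite setTI; apply: sub_sigma_algebra => f /=; rewrite in_itv/= andbT => rf.
exists ((phi f - r) / 2); first by rewrite divr_gt0// subr_gt0.
move=> g /lip; rewrite /= in_itv/= andbT => /ler_normlP[_]; lra.
Qed.

Lemma L2T_square_integrable f : square_integrable f.
Proof. exact/is_L2_square_integrable/L2_funP. Qed.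

Lemma L2norm_fin f : L2norm f \is a fin_num.
Proof.
have [_ _ foo] := L2_funP f; rewrite ge0_fin_numE//.
exact: Lnorm_ge0.
Qed.

Lemma sqr_mass_lt (h : measurableTypeR R -> R[i]%C) (r : R) :
  (L2norm h < r%:E)%E -> (sqr_mass h <= (r ^+ 2)%:E)%E.
Proof.
move=> hr; rewrite sqr_massE.
have h0 : (0 <= L2norm h)%E by exact: Lnorm_ge0.
have r0 : 0 < r by rewrite -lte_fin (le_lt_trans h0).
have hf : L2norm h \is a fin_num.
  by rewrite ge0_fin_numE// (lt_trans hr)// ltry.
move: hr h0; rewrite -(fineK hf) lte_fin lee_fin poweR_EFin lee_fin => hr h0.
by rewrite powR_mulrn// ler_pXn2r// ?nnegrE ltW.
Qed.

(** Bessel's inequality for a single frequency, applied to [f - g]. *)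
Lemma fourier_coef_lipschitz f g (k : int) (r : R) :
  (L2norm (fun x => f x - g x)%R < r%:E)%E ->
  normc (fourier_coef f k - fourier_coef g k) <= r.
Proof.
move=> fgr.
have fL2 := L2T_square_integrable f; have gL2 := L2T_square_integrable g.
have r0 : 0 < r by rewrite -lte_fin (le_lt_trans _ fgr)//; exact: Lnorm_ge0.
rewrite -fourier_coefB//.
have := normc_fourier_coef_le k (square_integrableB fL2 gL2).
move=> /le_trans /(_ (sqr_mass_lt fgr)); rewrite lee_fin => h.
rewrite -(ler_pXn2r (n := 2))// ?nnegrE ?normc_ge0 ?(ltW r0)//.
apply: le_trans h; rewrite ler_peMl ?sqr_ge0//.
by have := @pi_ge2 R; lra.
Qed.

Lemma measurable_Re_fourier_coef (k : int) :
  measurable_fun [set: L2B] (fun f : L2T R => Re (fourier_coef f k)).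
Proof.
apply: lipschitz_measurable => f g r fgr.
rewrite -ReN -ReD (le_trans (Re_le_normc _))//.
exact: fourier_coef_lipschitz.
Qed.

Lemma measurable_Im_fourier_coef (k : int) :
  measurable_fun [set: L2B] (fun f : L2T R => Im (fourier_coef f k)).
Proof.
apply: lipschitz_measurable => f g r fgr.
rewrite -ImN -ImD (le_trans (Im_le_normc _))//.
exact: fourier_coef_lipschitz.
Qed.

Lemma cmeasurable_fourier_coef (k : int) :
  @cmeasurable R _ L2B (fun f : L2T R => fourier_coef f k).
Proof. by split; [exact: measurable_Re_fourier_coef|exact: measurable_Im_fourier_coef]. Qed.

Lemma L2norm_triangle f g :
  (L2norm f <= L2norm (fun x => f x - g x)%R + L2norm g)%E.
Proof.
have [mf _] := L2T_square_integrable f; have [mg _] := L2T_square_integrable g.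
have mfg := cmeasurableB mf mg.
pose h x := normc (f x - g x) + normc (g x).
have mh : measurable_fun [set: measurableTypeR R] h.
  by apply: measurable_funD; exact: measurable_normc.
have h0 x : 0 <= h x by rewrite addr_ge0 ?normc_ge0.
have hE x : (`|(EFin \o h) x| `^ 2 = (h x ^+ 2)%:E)%E.
  by rewrite /comp abse_EFin poweR_EFin ger0_norm// powR_mulrn.
apply: (@le_trans _ _ (Lnorm torus_measure 2%:E (EFin \o h))).
  rewrite L2norm_sqr_mass unlock.
  apply: le_poweR; [by rewrite invr_ge0|exact: sqr_mass_ge0|].
  - apply: ge0_le_integral => //.
    + by move=> x _; rewrite lee_fin sqr_ge0.
    + by apply/measurable_EFinP; apply: measurable_funX; exact: measurable_normc.
    + by under eq_fun do rewrite hE; apply/measurable_EFinP; exact: measurable_funX.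
    + move=> x _; rewrite hE lee_fin ler_pXn2r ?nnegrE ?normc_ge0//.
      by rewrite (le_trans _ (le_normcD _ _))// subrK.
apply: (minkowski_EFin torus_measure (measurable_normc mfg) (measurable_normc mg)).
by rewrite ler1n.
Qed.

Lemma L2normB_sym f g :
  L2norm (fun x => f x - g x)%R = L2norm (fun x => g x - f x)%R.
Proof. by rewrite !L2norm_sqr_mass sqr_massBC. Qed.

Lemma measurable_L2norm :
  measurable_fun [set: L2B] (fun f : L2T R => fine (L2norm f)).
Proof.
apply: lipschitz_measurable => f g r fgr.
have d0 : (0 <= L2norm (fun x => f x - g x)%R)%E by exact: Lnorm_ge0.
have dfin : L2norm (fun x => f x - g x)%R \is a fin_num.
  by rewrite ge0_fin_numE// (lt_trans fgr)// ltry.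
have := L2norm_triangle f g; have := L2norm_triangle g f.
rewrite L2normB_sym; move: fgr.
rewrite -(fineK dfin) -(fineK (L2norm_fin f)) -(fineK (L2norm_fin g)).
rewrite -!EFinD !lee_fin lte_fin /= => h1 h2 h3.
by apply/ler_normlP; split; lra.
Qed.

End L2_functionals.

(** * Time integrals of the damped phase *)

Section zeta_partial_sums.
Context {R : realType}.

(** The comparison of the zeta series with an integral, in telescoping form. *)
Lemma powR_telescope (a : R) (n : nat) : 0 < a -> (0 < n)%N ->
  a * (n.+1%:R `^ (1 + a))^-1 <= (n%:R `^ a)^-1 - (n.+1%:R `^ a)^-1.
Proof.
move=> a0 n0.
have n0' : 0 < n%:R :> R by rewrite ltr0n.
have m0 : 0 < n.+1%:R :> R by rewrite ltr0n.
rewrite powRD ?(gt_eqF m0) ?implybT// (powRr1 (ltW m0)).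
set x := n.+1%:R `^ a; set y := n%:R `^ a.
have x0 : 0 < x by rewrite powR_gt0.
have y0 : 0 < y by rewrite powR_gt0.
rewrite -subr_ge0.
rewrite (_ : _ - _ = x^-1 * (x / y - 1 - a / n.+1%:R)); last first.
  by field; rewrite !gt_eqF.
rewrite mulr_ge0 ?invr_ge0 ?(ltW x0)//.
have -> : x / y = expR (a * ln (n.+1%:R / n%:R)).
  rewrite /x /y /powR !gt_eqF// -expRB ln_div ?posrE//.
  by rewrite mulrBr.
have h1 := expR_ge1Dx (a * ln (n.+1%:R / n%:R) : R).
have h2 : (n.+1%:R)^-1 <= ln (n.+1%:R / n%:R) :> R.
  have -> : n.+1%:R / n%:R = (1 + - n.+1%:R^-1)^-1 :> R.
    rewrite -[LHS]invf_div; congr (_^-1).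
    apply: (mulIf (lt0r_neq0 m0)).
    by rewrite divfK ?lt0r_neq0// mulrBl mul1r mulVf ?lt0r_neq0// -natr1 addrK.
  rewrite lnV ?posrE; last first.
    by rewrite subr_gt0 invf_lt1 ?ltr1n.
  rewrite lerNr; apply: le_ln1Dx.
  by rewrite ltrN2 invf_lt1 ?ltr1n.
have := ler_wpM2l (ltW a0) h2.
by move: h1; set E := expR _; set L := a * ln _; set Q := a / _ => h1 h3; lra.
Qed.

Lemma zeta_partial_sum_le (a : R) (n : nat) : 0 < a ->
  \sum_(m < n) (m.+1%:R `^ (1 + a))^-1 <= 1 + a^-1.
Proof.
move=> a0.
case: n => [|n]; first by rewrite big_ord0 addr_ge0// invr_ge0 ltW.
suff : \sum_(m < n.+1) (m.+1%:R `^ (1 + a))^-1 <= 1 + a^-1 * (1 - (n.+1%:R `^ a)^-1).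
  by move=> /le_trans; apply; rewrite lerD2l ler_piMr ?invr_ge0 ?(ltW a0)// gerBl invr_ge0 powR_ge0.
elim: n => [|n IH]; first by rewrite big_ord_recr big_ord0 /= !powR1 invr1 subrr mulr0 addr0 add0r.
rewrite big_ord_recr /=.
have := powR_telescope a0 (ltn0Sn n).
rewrite -ler_pdivlMl// => h.
apply: le_trans (lerD IH h) _.
by rewrite -addrA -mulrDr addrA subrK.
Qed.

End zeta_partial_sums.

Section phase_kernel.
Context {R : realType}.
Local Notation leb := (@lebesgue_measure R).
Implicit Types T l c : R.

(** A geometric mean of the two bounds [T] and [c]. *)
Lemma interpolation_min (x T c theta : R) : 0 <= theta <= 1 -> 0 <= x ->
  x <= T -> x <= c -> x <= T `^ (1 - theta) * c `^ theta.
Proof.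
move=> /andP[t0 t1] x0 xT xc.
have [->|xn0] := eqVneq x 0; first by rewrite mulr_ge0 ?powR_ge0.
rewrite -[leLHS](powRr1 x0) -(subrK theta 1) powRD; last by rewrite xn0 implybT.
rewrite (subrK theta 1); apply: ler_pM; rewrite ?powR_ge0//.
- by apply: ge0_ler_powR; rewrite ?nnegrE ?subr_ge0// (le_trans x0).
- by apply: ge0_ler_powR; rewrite ?nnegrE// (le_trans x0).
Qed.

Definition phase_kernel T l : \bar R :=
  (\int[leb]_(t in `[0%R, T]) (expR (- (t * l ^+ 2) / 2))%:E)%E.

Let measurable_integrand l :
  measurable_fun [set: measurableTypeR R] (fun t : R => (expR (- (t * l ^+ 2) / 2))%:E).
Proof.
apply/measurable_EFinP; apply: measurableT_comp => //.
by apply: measurable_funM => //; apply: measurable_funN; exact: measurable_funM.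
Qed.

Lemma phase_kernel_ge0 T l : (0 <= phase_kernel T l)%E.
Proof. by apply: integral_ge0 => t _; rewrite lee_fin expR_ge0. Qed.

Lemma phase_kernel_le_time T l : 0 < T -> (phase_kernel T l <= T%:E)%E.
Proof.
move=> T0; apply: (@le_trans _ _ (\int[leb]_(t in `[0%R, T]) (cst 1%:E t))%E).
  apply: ge0_le_integral => //.
  - exact: measurable_funTS.
  - move=> t /=; rewrite in_itv/= => /andP[t0 _].
    rewrite lee_fin -[leRHS]expR0 ler_expR mulNr oppr_le0.
    by apply: divr_ge0 => //; apply: mulr_ge0 => //; exact: sqr_ge0.
by rewrite integral_cst//= mul1e lebesgue_measure_itv/= lte_fin T0 sube0.
Qed.

(** Up to normalization the integrand is the exponential density of rate
    [l^2 / 2], whose total mass is 1. *)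
Lemma phase_kernel_le_rate T l : 0 < T -> l != 0 ->
  (phase_kernel T l <= ((l ^+ 2 / 2)^-1)%:E)%E.
Proof.
move=> T0 l0; set c := l ^+ 2 / 2.
have c0 : 0 < c by rewrite divr_gt0// exprn_even_gt0.
have := @exponential_prob_itv0c R c T T0.
rewrite /exponential_prob => E.
have -> : phase_kernel T l = (c^-1%:E * \int[leb]_(t in `[0%R, T]) (exponential_pdf c t)%:E)%E.
  rewrite -ge0_integralZl//; last 3 first.
  - apply/measurable_EFinP; apply: measurable_funTS.
    exact: measurable_exponential_pdf.
  - by move=> t _; rewrite lee_fin exponential_pdf_ge0// ltW.
  - by rewrite lee_fin invr_ge0 ltW.
  apply: eq_integral => t; rewrite inE/= in_itv/= => /andP[t0 _].
  rewrite exponential_pdfE// -EFinM mulKf ?gt_eqF//.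
  by congr (expR _)%:E; rewrite /c; ring.
by rewrite E -EFinB -EFinM lee_fin ler_piMr ?invr_ge0 ?(ltW c0)// gerBl expR_ge0.
Qed.

Lemma phase_kernel_le_interpolation T l theta : 0 <= theta <= 1 -> 0 < T -> l != 0 ->
  (phase_kernel T l <= (T `^ (1 - theta) * (l ^+ 2 / 2)^-1 `^ theta)%:E)%E.
Proof.
move=> th T0 l0.
have h0 := phase_kernel_ge0 T l; have h1 := phase_kernel_le_time l T0.
have h2 := phase_kernel_le_rate T0 l0.
have hf : phase_kernel T l \is a fin_num by rewrite ge0_fin_numE// (le_lt_trans h1)// ltry.
move: h0 h1 h2; rewrite -(fineK hf) !lee_fin => h0 h1 h2.
exact: interpolation_min.
Qed.

(** A vanishing frequency gap leaves a phase without oscillation, so that only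
    the trivial bound [T] remains. Otherwise the exponent is [2 alpha] because the
    product of the powers [- alpha] of two gaps is split into a sum of squares. *)
Definition weight T (alpha : R) (m : nat) : R :=
  if m == 0%N then T else T `^ (1 - alpha / 2) * (m%:R `^ (2 * alpha))^-1.

Lemma weight_ge0 T alpha m : 0 < T -> 0 <= weight T alpha m.
Proof.
move=> T0; rewrite /weight; case: ifP => _; first exact: ltW.
by rewrite mulr_ge0 ?invr_ge0 ?powR_ge0.
Qed.

Lemma phase_kernel_le_weight T alpha (m n : int) : 0 < T -> 0 <= alpha <= 2 ->
  (phase_kernel T (2 * m%:~R * n%:~R) <=
   (weight T alpha `|m|%N + weight T alpha `|n|%N)%:E)%E.
Proof.
move=> T0 /andP[a0 a2].
have [m0|m0] := eqVneq m 0.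
  rewrite (le_trans (phase_kernel_le_time _ T0))// lee_fin.
  by rewrite {1}/weight m0 absz0 eqxx lerDl weight_ge0.
have [n0|n0] := eqVneq n 0.
  rewrite (le_trans (phase_kernel_le_time _ T0))// lee_fin.
  by rewrite {2}/weight n0 absz0 eqxx lerDr weight_ge0.
have mr0 : m%:~R != 0 :> R by rewrite intr_eq0.
have nr0 : n%:~R != 0 :> R by rewrite intr_eq0.
have th : 0 <= alpha / 2 <= 1 by apply/andP; split; lra.
have l0 : 2 * m%:~R * n%:~R != 0 :> R by rewrite !mulf_neq0.
apply: (le_trans (phase_kernel_le_interpolation th T0 l0)); rewrite lee_fin.
rewrite /weight !absz_eq0 (negbTE m0) (negbTE n0) -mulrDr.
apply: ler_wpM2l; first exact: powR_ge0.
rewrite !natr_absz !intr_norm.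
set x : R := `|m%:~R|; set y : R := `|n%:~R|.
have x0 : 0 < x by rewrite normr_gt0.
have y0 : 0 < y by rewrite normr_gt0.
have E : (2 * m%:~R * n%:~R) ^+ 2 / 2 = 2 * (x * y) ^+ 2 :> R.
  by rewrite /x /y -normrM real_normK ?num_real//; field.
rewrite E.
have xy0 : 0 < x * y by rewrite mulr_gt0.
apply: (@le_trans _ _ (((x * y) ^+ 2)^-1 `^ (alpha / 2))).
  have [th0 _] := andP th.
  have q0 : 0 < (x * y) ^+ 2 by rewrite exprn_gt0.
  apply: (ge0_ler_powR th0).
  - by rewrite nnegrE invr_ge0 pmulr_rge0// ltW.
  - by rewrite nnegrE invr_ge0 ltW.
  by rewrite lef_pV2 ?posrE ?pmulr_rgt0// ler_peMl ?ler1n// ltW.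
have -> : ((x * y) ^+ 2)^-1 `^ (alpha / 2) = (x `^ alpha)^-1 * (y `^ alpha)^-1.
  rewrite -[((x * y) ^+ 2)^-1]powR_inv1 ?sqr_ge0// -powRrM -powR_mulrn ?(ltW xy0)// -powRrM.
  rewrite (_ : 2 * _ = - alpha); last by field.
  by rewrite powRN powRM ?(ltW x0) ?(ltW y0)// invfM.
have sq z : 0 < z -> (z `^ (2 * alpha))^-1 = ((z `^ alpha)^-1) ^+ 2.
  move=> z0; rewrite mulrC powRrM powR_mulrn ?powR_ge0// exprVn//.
rewrite !sq//.
set u := (x `^ alpha)^-1; set v := (y `^ alpha)^-1.
have := sqr_ge0 (u - v); have := sqr_ge0 u; have := sqr_ge0 v; nra.
Qed.

Lemma sum_weight_le T alpha (n : nat) : 0 < T -> 2^-1 < alpha ->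
  \sum_(m < n) weight T alpha m <=
  (2 + (2 * alpha - 1)^-1) * (T + T `^ (1 - alpha / 2)).
Proof.
move=> T0 ha; have a0 : 0 < 2 * alpha - 1 by lra.
set A := T `^ _; have A0 : 0 <= A by exact: powR_ge0.
have Z0 : 0 <= (2 * alpha - 1)^-1 by rewrite invr_ge0 ltW.
case: n => [|n]; first by rewrite big_ord0 mulr_ge0 ?addr_ge0 ?(ltW T0).
rewrite big_ord_recl /= {1}/weight eqxx.
have -> : \sum_(i < n) weight T alpha (bump 0 i) =
          A * \sum_(i < n) (i.+1%:R `^ (1 + (2 * alpha - 1)))^-1.
  rewrite mulr_sumr; apply: eq_bigr => i _.
  by rewrite /weight /bump /= add1n -/A (_ : 1 + _ = 2 * alpha)//; ring.
have := ler_wpM2l A0 (zeta_partial_sum_le n a0).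
have := mulr_ge0 Z0 (ltW T0); nra.
Qed.

End phase_kernel.

(** * Counting additive quadruples *)

Section additive_quadruples.
Context {R : realType} (n : nat).
Variables (b : 'I_n -> R) (g : nat -> R).
Hypothesis g_ge0 : forall m, 0 <= g m.

Let dist (i j : 'I_n) : nat := `|i%:Z - j%:Z|%N.
Let H i j := g (dist i j).
Let Gamma := \sum_(m < n) g m.
Let E := \sum_i b i ^+ 2.

Let H_ge0 i j : 0 <= H i j. Proof. exact: g_ge0. Qed.

Let H_sym i j : H i j = H j i. Proof. by rewrite /H /dist distnC. Qed.

(** Each distance to [i] is taken at most once on either side of [i]. *)
Lemma sum_dist_le (i : 'I_n) : \sum_(j < n) g `|i%:Z - j%:Z|%N <= 2 * Gamma.
Proof.
have n0 : (0 < n)%N by rewrite (leq_trans _ (ltn_ord i)).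
have low (m : nat) : (m <= n)%N -> \sum_(k < m) g k <= Gamma.
  move=> mn; rewrite /Gamma -(subnKC mn) big_split_ord /= lerDl.
  by apply: sumr_ge0 => k _; exact: g_ge0.
pose F (j : nat) := g `|i%:Z - j%:Z|%N.
rewrite -(big_mkord xpredT F) (big_cat_nat (n := i.+1))//=.
rewrite mulr2n mulrDl mul1r; apply: lerD.
- rewrite big_nat_rev /= big_mkord add0n.
  rewrite (eq_bigr (fun k : 'I_i.+1 => g k)); first exact: low.
  move=> k _; rewrite /F subSS; congr g.
  have := ltn_ord k; rewrite ltnS => ki.
  by rewrite -subzn// opprB addrC subrK absz_nat.
- rewrite -{1}(add0n i.+1) big_addn big_mkord.
  apply: (@le_trans _ _ (\sum_(k < (n - i.+1).+1) g k)); last first.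
    by apply: low; rewrite subnS prednK ?leq_subr// subn_gt0.
  rewrite big_ord_recl -[leLHS]add0r lerD//.
  rewrite le_eqVlt; apply/orP; left; apply/eqP; apply: eq_bigr => k _.
  rewrite /F; congr g.
  by rewrite distnC -addSnnS PoszD addrK lift0.
Qed.

Let sum_H_le i : \sum_(j < n) H i j <= 2 * Gamma.
Proof. exact: sum_dist_le. Qed.

Let sum_H_le' i : \sum_(j < n) H j i <= 2 * Gamma.
Proof. by under eq_bigr do rewrite H_sym; exact: sum_H_le. Qed.

Let sum_unique_le (c : pred 'I_n) (x : R) : 0 <= x ->
  (forall i j, c i -> c j -> i = j) -> \sum_(i | c i) x <= x.
Proof.
move=> x0 cinj; rewrite sumr_const -[leRHS]mulr1n ler_wpMn2l//.
by apply/card_le1_eqP => i j ci cj; exact: cinj.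
Qed.

(** The terms of an additive quadruple are bounded by
    [b1 b2 b3 b4 <= (b1^2 b3^2 + b2^2 b4^2) / 2], and two opposite indices
    together with a third one determine the quadruple. *)
Lemma additive_quadruples_le :
  \sum_(k1 < n) \sum_(k2 < n) \sum_(k3 < n) \sum_(k4 < n | (k1 + k3 == k2 + k4)%N)
     b k1 * b k2 * (b k3 * b k4) * (g `|k1%:Z - k2%:Z|%N + g `|k2%:Z - k3%:Z|%N)
  <= 4 * Gamma * E ^+ 2.
Proof.
pose S1 := \sum_(k1 < n) \sum_(k2 < n) \sum_(k3 < n) \sum_(k4 < n | (k1 + k3 == k2 + k4)%N)
   2^-1 * (b k1 ^+ 2 * b k3 ^+ 2 * (H k1 k2 + H k2 k3)).
pose S2 := \sum_(k1 < n) \sum_(k2 < n) \sum_(k3 < n) \sum_(k4 < n | (k1 + k3 == k2 + k4)%N)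
   2^-1 * (b k2 ^+ 2 * b k4 ^+ 2 * (H k1 k2 + H k1 k4)).
have prod_le k1 k2 : 0 <= b k1 ^+ 2 * b k2 ^+ 2 by rewrite mulr_ge0 ?sqr_ge0.
apply: (@le_trans _ _ (S1 + S2)).
  rewrite /S1 /S2 -big_split; apply: ler_sum => k1 _.
  rewrite -big_split; apply: ler_sum => k2 _.
  rewrite -big_split; apply: ler_sum => k3 _.
  rewrite -big_split; apply: ler_sum => k4 /eqP k1234 /=.
  have -> : H k1 k4 = H k2 k3.
    rewrite /H /dist; congr (g `|_|%N).
    by apply/eqP; rewrite subr_eq addrAC eq_sym subr_eq -!PoszD k1234 addnC.
  rewrite -/(dist k1 k2) -/(dist k2 k3) -/(H k1 k2) -/(H k2 k3).
  rewrite -mulrDr -mulrDl [leRHS]mulrA.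
  apply: ler_wpM2r; first by apply: addr_ge0; exact: H_ge0.
  by have := sqr_ge0 (b k1 * b k3 - b k2 * b k4); nra.
have bound : 2 * Gamma * E ^+ 2 = 2^-1 * \sum_(k1 < n) \sum_(k3 < n) b k1 ^+ 2 * b k3 ^+ 2 * (4 * Gamma).
  under eq_bigr do rewrite -mulr_suml -mulr_sumr.
  by rewrite -!mulr_suml -/E; field.
rewrite (_ : 4 * Gamma * E ^+ 2 = 2 * Gamma * E ^+ 2 + 2 * Gamma * E ^+ 2); last by ring.
apply: lerD.
- apply: (@le_trans _ _ (\sum_(k1 < n) \sum_(k2 < n) \sum_(k3 < n) 2^-1 * (b k1 ^+ 2 * b k3 ^+ 2 * (H k1 k2 + H k2 k3)))).
    apply: ler_sum => k1 _; apply: ler_sum => k2 _; apply: ler_sum => k3 _.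
    apply: sum_unique_le; first by rewrite mulr_ge0// mulr_ge0// addr_ge0.
    by move=> i j /eqP ci /eqP cj; apply/val_inj/eqP; rewrite -(eqn_add2l k2) -ci -cj.
  rewrite bound mulr_sumr; apply: ler_sum => k1 _.
  rewrite exchange_big mulr_sumr; apply: ler_sum => k3 _.
  rewrite -!mulr_sumr; apply: ler_wpM2l => //; apply: ler_wpM2l => //.
  rewrite big_split /=.
  by have := sum_H_le k1; have := sum_H_le' k3; lra.
- apply: (@le_trans _ _ (\sum_(k1 < n) \sum_(k2 < n) \sum_(k4 < n) 2^-1 * (b k2 ^+ 2 * b k4 ^+ 2 * (H k1 k2 + H k1 k4)))).
    apply: ler_sum => k1 _; apply: ler_sum => k2 _.
    rewrite (exchange_big_dep xpredT)//=; apply: ler_sum => k4 _.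
    apply: sum_unique_le; first by rewrite mulr_ge0// mulr_ge0// addr_ge0.
    by move=> i j /eqP ci /eqP cj; apply/val_inj/eqP; rewrite -(eqn_add2l k1) ci cj.
  rewrite exchange_big bound mulr_sumr; apply: ler_sum => k2 _.
  rewrite exchange_big mulr_sumr; apply: ler_sum => k4 _.
  rewrite -!mulr_sumr; apply: ler_wpM2l => //; apply: ler_wpM2l => //.
  rewrite big_split /=.
  by have := sum_H_le' k2; have := sum_H_le' k4; lra.
Qed.

End additive_quadruples.

(** * The fourth power of a truncated evolution *)

Section partial_sums.
Context {R : realType}.
Local Open Scope complex_scope.
Local Notation mu := (@torus_measure R).
Local Notation leb := (@lebesgue_measure R).
Implicit Types (f : measurableTypeR R -> R[i]) (s T : R) (N : nat).

Definition freq N (j : 'I_(N.*2.+1)) : int := j%:Z - N%:Z.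

Lemma freq_inj N : injective (@freq N).
Proof. by move=> i j /addIr [] /val_inj. Qed.

Lemma evolution_partial_sumE s f N :
  evolution_partial_sum s f N =
  trig_poly (fun j : 'I_(N.*2.+1) =>
    fourier_coef f (freq j) * expi ((freq j ^+ 2)%:~R * s)) (@freq N).
Proof.
apply/funext => x; apply: eq_bigr => j _; rewrite -mulrA; congr (_ * _).
by rewrite [LHS]expiD mulrC.
Qed.

Definition energy f N : R :=
  \sum_(j < N.*2.+1) normc (fourier_coef f (freq j)) ^+ 2.

Lemma energy_ge0 f N : 0 <= energy f N.
Proof. by apply: sumr_ge0 => j _; exact: sqr_ge0. Qed.

Lemma energy_le f N : square_integrable f ->
  ((2 * pi * energy f N)%:E <= sqr_mass f)%E.
Proof. by move=> fL2; apply: bessel => //; exact: freq_inj. Qed.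

(** A quadruple [((k1, k2), (k3, k4))] stands for the product of the modes
    [k1], [k3] and of the conjugates of the modes [k2], [k4]. *)
Definition quad N : finType := (('I_(N.*2.+1) * 'I_(N.*2.+1)) * ('I_(N.*2.+1) * 'I_(N.*2.+1)))%type.

Definition quad_freq N (q : quad N) : int :=
  (freq q.1.1 - freq q.1.2) + (freq q.2.1 - freq q.2.2).

Definition quad_phase N (q : quad N) : int :=
  (freq q.1.1 ^+ 2 - freq q.1.2 ^+ 2) + (freq q.2.1 ^+ 2 - freq q.2.2 ^+ 2).

Definition quad_coef f N (q : quad N) : R[i] :=
  (fourier_coef f (freq q.1.1) * conjc (fourier_coef f (freq q.1.2))) *
  (fourier_coef f (freq q.2.1) * conjc (fourier_coef f (freq q.2.2))).

Definition quartic_phase f N s : R :=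
  2 * pi * \sum_(q : quad N | quad_freq q == 0)
    Re (quad_coef f q * expi ((quad_phase q)%:~R * s)).

Lemma quartic_mass_partial_sum s f N :
  (\int[mu]_x (normc (evolution_partial_sum s f N x) ^+ 4)%:E)%E =
  (quartic_phase f N s)%:E.
Proof.
under eq_integral do rewrite evolution_partial_sumE pow4_normc_trig_poly.
rewrite integral_trig; congr (_ * _)%:E; apply: eq_bigr => q _; congr Re.
rewrite /quad_coef /quad_phase.
move: (fourier_coef f (freq q.1.1)) (fourier_coef f (freq q.1.2)) => a1 a2.
move: (fourier_coef f (freq q.2.1)) (fourier_coef f (freq q.2.2)) => a3 a4.
rewrite !conjcM !conjc_expi !intrD !intrN !mulrDl !expiD !mulNr.
by ring.
Qed.

Lemma quartic_phase_ge0 f N s : 0 <= quartic_phase f N s.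
Proof.
rewrite -lee_fin -quartic_mass_partial_sum; apply: integral_ge0 => x _.
by rewrite lee_fin exprn_ge0// normc_ge0.
Qed.

Lemma quad_freq_eq0 N (q : quad N) :
  (quad_freq q == 0) = (q.1.1 + q.2.1 == q.1.2 + q.2.2)%N.
Proof.
case: q => -[k1 k2] [k3 k4] /=; rewrite /quad_freq /freq /=.
by rewrite -eqz_nat !PoszD -[RHS]subr_eq0; congr (_ == _); ring.
Qed.

(** On additive quadruples the quadratic phase splits into two frequency gaps,
    which is the source of its oscillation. *)
Lemma quad_phaseE N (q : quad N) : quad_freq q = 0 ->
  quad_phase q = 2 * (q.1.1%:Z - q.1.2%:Z) * (q.1.2%:Z - q.2.1%:Z).
Proof.
case: q => -[k1 k2] [k3 k4] /=; rewrite /quad_freq /quad_phase /freq /= => h.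
have -> : k4%:Z = k1%:Z - k2%:Z + k3%:Z.
  by apply/eqP; rewrite -subr_eq0 -oppr_eq0 -[X in _ == X]h; apply/eqP; ring.
by ring.
Qed.

Lemma normc_quad_coef f N (q : quad N) : normc (quad_coef f q) =
  normc (fourier_coef f (freq q.1.1)) * normc (fourier_coef f (freq q.1.2)) *
  (normc (fourier_coef f (freq q.2.1)) * normc (fourier_coef f (freq q.2.2))).
Proof.
rewrite /quad_coef.
move: (fourier_coef f (freq q.1.1)) (fourier_coef f (freq q.1.2)) => a1 a2.
move: (fourier_coef f (freq q.2.1)) (fourier_coef f (freq q.2.2)) => a3 a4.
by rewrite !normcM !normc_conjc.
Qed.

(** What remains of [quartic_phase] after averaging the phases over a Brownian
    path at time [t] and taking absolute values. *)
Definition quartic_damped f N (t : R) : R :=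
  2 * pi * \sum_(q : quad N | quad_freq q == 0)
    normc (quad_coef f q) * expR (- (t * (quad_phase q)%:~R ^+ 2) / 2).

Let pi2_ge0 : 0 <= 2 * pi :> R.
Proof. by rewrite mulr_ge0// pi_ge0. Qed.

Lemma quartic_damped_ge0 f N t : 0 <= quartic_damped f N t.
Proof.
rewrite mulr_ge0//; apply: sumr_ge0 => q _.
by rewrite mulr_ge0 ?normc_ge0 ?expR_ge0.
Qed.

(** Integrating the damping in time leaves, for each additive quadruple, the
    kernel of the product of the two frequency gaps. *)
Lemma integral_quartic_damped_le T alpha f N : 0 < T -> 0 <= alpha <= 2 ->
  (\int[leb]_(t in `[0%R, T]) (quartic_damped f N t)%:E <=
   (2 * pi * (4 * (\sum_(m < N.*2.+1) weight T alpha m) * energy f N ^+ 2))%:E)%E.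
Proof.
move=> T0 ha.
have mexp (l : R) : measurable_fun (`[0, T] : set (measurableTypeR R))
    (fun t : R => expR (- (t * l ^+ 2) / 2)).
  apply: measurable_funTS; apply: measurableT_comp => //.
  by apply: measurable_funM => //; apply: measurable_funN; exact: measurable_funM.
under eq_integral do rewrite /quartic_damped -big_filter EFinM -sumEFin.
rewrite ge0_integralZl_EFin//; last 2 first.
- move=> t _; apply: sume_ge0 => q _.
  by rewrite lee_fin mulr_ge0 ?normc_ge0 ?expR_ge0.
- apply: emeasurable_sum => q.
  by apply/measurable_EFinP; apply: measurable_funM.
rewrite [leRHS]EFinM lee_wpmul2l ?lee_fin//.
rewrite ge0_integral_sum//; last 2 first.
- by move=> q; apply/measurable_EFinP; apply: measurable_funM.
- by move=> q t _; rewrite lee_fin mulr_ge0 ?normc_ge0 ?expR_ge0.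
rewrite big_filter.
pose w (q : quad N) := weight T alpha `|q.1.1%:Z - q.1.2%:Z|%N +
                       weight T alpha `|q.1.2%:Z - q.2.1%:Z|%N.
have termwise (q : quad N) : quad_freq q == 0 ->
    (\int[leb]_(t in `[0%R, T]) (normc (quad_coef f q) *
       expR (- (t * (quad_phase q)%:~R ^+ 2) / 2))%:E <= (normc (quad_coef f q) * w q)%:E)%E.
  move=> /eqP q0.
  under eq_integral do rewrite EFinM.
  rewrite ge0_integralZl_EFin ?normc_ge0//; last exact/measurable_EFinP.
  rewrite [leRHS]EFinM lee_wpmul2l ?lee_fin ?normc_ge0//.
  rewrite -/(phase_kernel T (quad_phase q)%:~R) quad_phaseE// !intrM.
  exact: phase_kernel_le_weight.
apply: (le_trans (lee_sum _ termwise)).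
rewrite sumEFin lee_fin.
have g0 m : 0 <= weight T alpha m by exact: weight_ge0.
pose b (j : 'I_(N.*2.+1)) := normc (fourier_coef f (freq j)).
have -> : energy f N = \sum_j b j ^+ 2 by [].
have -> : \sum_(q : quad N | quad_freq q == 0) normc (quad_coef f q) * w q =
    \sum_(q : quad N | (q.1.1 + q.2.1 == q.1.2 + q.2.2)%N)
      b q.1.1 * b q.1.2 * (b q.2.1 * b q.2.2) * w q.
  by apply: eq_big => q; [exact: quad_freq_eq0|rewrite normc_quad_coef].
clearbody b.
apply: le_trans (additive_quadruples_le b g0).
rewrite le_eqVlt; apply/orP; left; apply/eqP.
rewrite big_mkcond -(pair_bigA _ (fun p r : 'I_(N.*2.+1) * 'I_(N.*2.+1) =>
  if (p.1 + r.1 == p.2 + r.2)%N then b p.1 * b p.2 * (b r.1 * b r.2) * w (p, r) else 0)) /=.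
rewrite -(pair_bigA _ (fun k1 k2 : 'I_(N.*2.+1) => \sum_(r : 'I_(N.*2.+1) * 'I_(N.*2.+1))
  if (k1 + r.1 == k2 + r.2)%N then b k1 * b k2 * (b r.1 * b r.2) * w ((k1, k2), r) else 0)) /=.
apply: eq_bigr => k1 _; apply: eq_bigr => k2 _.
rewrite -(pair_bigA _ (fun k3 k4 : 'I_(N.*2.+1) =>
  if (k1 + k3 == k2 + k4)%N then b k1 * b k2 * (b k3 * b k4) * w ((k1, k2), (k3, k4)) else 0)) /=.
by apply: eq_bigr => k3 _; rewrite -big_mkcond.
Qed.

End partial_sums.

(** * Averages over the datum, the path and the time *)

Section measurable_sums.
Context d (X : measurableType d) {R : realType}.

Lemma measurable_fun_sum_real I (r : seq I) (Q : pred I) (F : I -> X -> R) :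
  (forall i, measurable_fun [set: X] (F i)) ->
  measurable_fun [set: X] (fun x => \sum_(i <- r | Q i) F i x).
Proof.
move=> mF; elim: r => [|i r IH].
  by under eq_fun do rewrite big_nil; exact: measurable_cst.
under eq_fun do rewrite big_cons.
by case: (Q i) => //; exact: measurable_funD.
Qed.

Lemma cmeasurable_expiZ (l : R) (h : X -> R) :
  measurable_fun [set: X] h -> cmeasurable (fun x => expi (l * h x)).
Proof. by move=> mh; apply: cmeasurable_expi; exact: measurable_funM. Qed.

End measurable_sums.

Section random_initial_data.
Context d (Omega : measurableType d) {R : realType} (P : probability Omega R).
Local Notation L2B := (g_sigma_algebraType (@L2_open R)).
Variable u : Omega -> L2T R.
Hypothesis uL4 : in_L4L2 P u.

Lemma measurable_L2_data : measurable_fun [set: Omega] (u : Omega -> L2B).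
Proof.
by move=> _ A mA; have [sub _] := uL4; apply: sub; exists A.
Qed.

Lemma measurable_L2_functional (phi : L2T R -> R) :
  measurable_fun [set: L2B] phi -> measurable_fun [set: Omega] (phi \o u).
Proof. by move=> mphi; exact: measurableT_comp mphi measurable_L2_data. Qed.

Lemma sigma_L2_functional (phi : L2T R -> R) (A : set R) :
  measurable_fun [set: L2B] phi -> measurable A -> sigma_L2 u ((phi \o u) @^-1` A).
Proof.
move=> mphi mA; exists (phi @^-1` A); last by rewrite setTI.
have := mphi measurableT A mA; rewrite setTI; exact.
Qed.

Definition data_norm (w : Omega) : R := fine (L2norm (u w)).

Lemma data_norm_ge0 w : 0 <= data_norm w.
Proof. by rewrite fine_ge0//; exact: Lnorm_ge0. Qed.

Lemma measurable_data_norm : measurable_fun [set: Omega] data_norm.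
Proof. exact: (measurable_L2_functional measurable_L2norm). Qed.

Lemma L4L2norm_pow4 : (L4L2norm P u `^ 4 = \int[P]_w (data_norm w ^+ 4)%:E)%E.
Proof.
rewrite /L4L2norm poweR_Lnorm//; apply: eq_integral => w _.
rewrite -(fineK (L2norm_fin (u w))) abse_EFin poweR_EFin.
by rewrite ger0_norm ?data_norm_ge0// powR_mulrn ?data_norm_ge0.
Qed.

Lemma integrable_data_norm_pow4 :
  P.-integrable setT (fun w => (data_norm w ^+ 4)%:E).
Proof.
apply/integrableP; split.
  by apply/measurable_EFinP; apply: measurable_funX; exact: measurable_data_norm.
under eq_integral do rewrite abse_EFin ger0_norm ?exprn_ge0 ?data_norm_ge0//.
by rewrite -L4L2norm_pow4 poweR_lty//; case: uL4.
Qed.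

Lemma energy_data_le (w : Omega) (N : nat) :
  2 * pi * energy (u w) N <= data_norm w ^+ 2.
Proof.
have := energy_le N (L2T_square_integrable (u w)).
rewrite sqr_massE -(fineK (L2norm_fin (u w))) poweR_EFin lee_fin.
by rewrite powR_mulrn// data_norm_ge0.
Qed.

Let cmeasurable_coef k : @cmeasurable R _ L2B (fun f : L2T R => fourier_coef f k).
Proof. exact: cmeasurable_fourier_coef. Qed.

Lemma cmeasurable_quad_coef (N : nat) (q : quad N) :
  @cmeasurable R _ L2B (fun f : L2T R => quad_coef f q).
Proof.
by apply: cmeasurableM; apply: cmeasurableM => //; exact: cmeasurable_conjc.
Qed.

Lemma cmeasurable_quad_data (N : nat) (q : quad N) :
  cmeasurable (fun w => quad_coef (u w) q).
Proof.
have [mR mI] := cmeasurable_quad_coef q.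
by split; [exact: (measurable_L2_functional mR)|exact: (measurable_L2_functional mI)].
Qed.

Lemma normc_fourier_coef_le_energy (f : measurableTypeR R -> R[i]%C) N (j : 'I_(N.*2.+1)) :
  normc (fourier_coef f (freq j)) ^+ 2 <= energy f N.
Proof.
rewrite /energy (bigD1 j)//= lerDl; apply: sumr_ge0 => i _; exact: sqr_ge0.
Qed.

Lemma mul_le_of_sqr (x y z : R) : x ^+ 2 <= z -> y ^+ 2 <= z -> x * y <= z.
Proof. by move=> xz yz; have := sqr_ge0 (x - y); nra. Qed.

Lemma normc_quad_coef_le (f : measurableTypeR R -> R[i]%C) (N : nat) (q : quad N) :
  normc (quad_coef f q) <= energy f N ^+ 2.
Proof.
have h j := @normc_fourier_coef_le_energy f N j.
rewrite normc_quad_coef expr2; apply: ler_pM; rewrite ?mulr_ge0 ?normc_ge0//.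
- exact: mul_le_of_sqr (h _) (h _).
- exact: mul_le_of_sqr (h _) (h _).
Qed.

(** A quadruple is quartic in the datum, and fourth moments are finite. *)
Lemma integrable_quad_data (N : nat) (q : quad N) :
  P.-integrable setT (fun w => (normc (quad_coef (u w) q))%:E).
Proof.
apply: (@dominated_integrable_EFin _ _ _ P _ (fun w => (2 * pi) ^- 2 * data_norm w ^+ 4)).
- exact: measurable_normc (cmeasurable_quad_data q).
- move=> w; rewrite ger0_norm ?normc_ge0//.
  apply: le_trans (normc_quad_coef_le _ _) _.
  have p2 : 0 < 2 * pi :> R by rewrite mulr_gt0// pi_gt0.
  rewrite -[leLHS](mulKf (lt0r_neq0 (exprn_gt0 2 p2))) -exprMn.
  apply: ler_wpM2l; first by rewrite invr_ge0 exprn_ge0// ltW.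
  have -> : data_norm w ^+ 4 = (data_norm w ^+ 2) ^+ 2 by rewrite -exprM.
  have a0 : 0 <= 2 * pi * energy (u w) N by apply: mulr_ge0; [exact: ltW|exact: energy_ge0].
  by rewrite ler_pXn2r ?nnegrE ?sqr_ge0//; exact: energy_data_le.
- apply: integrableZl_EFin; exact: integrable_data_norm_pow4.
Qed.

Section brownian.
Variable W : R -> Omega -> R.
Hypothesis BM : is_brownian P W.
Hypothesis indep : independent_sigma P (sigma_L2 u) (sigma_process W).

Lemma integrable_quad_phase (N : nat) (q : quad N) (Y : Omega -> R) (l : R) :
  measurable_fun [set: Omega] Y ->
  P.-integrable setT (fun w => (Re (quad_coef (u w) q * expi (l * Y w)))%:E).
Proof.
move=> mY; apply: (@dominated_integrable_EFin _ _ _ P _ (fun w => normc (quad_coef (u w) q))).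
- have [] // := cmeasurableM (cmeasurable_quad_data q) (cmeasurable_expiZ l mY).
- by move=> w; exact: Re_expi_le.
- exact: integrable_quad_data.
Qed.

Lemma measurable_quartic_phase d' (X : measurableType d') (h : X -> Omega) (Y : X -> R) N :
  measurable_fun [set: X] h -> measurable_fun [set: X] Y ->
  measurable_fun [set: X] (fun x => quartic_phase (u (h x)) N (Y x)).
Proof.
move=> mh mY; apply: measurable_funM => //.
apply: measurable_fun_sum_real => q.
have [mR mI] := cmeasurable_quad_data q.
have mq : cmeasurable (fun x => quad_coef (u (h x)) q).
  by split; [exact: (measurableT_comp mR mh)|exact: (measurableT_comp mI mh)].
by have [] := cmeasurableM mq (cmeasurable_expiZ (quad_phase q)%:~R mY).
Qed.

Lemma measurable_quartic_damped N :
  measurable_fun [set: (Omega * measurableTypeR R)%type]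
    (fun p => quartic_damped (u p.1) N p.2).
Proof.
apply: measurable_funM => //; apply: measurable_fun_sum_real => q.
apply: measurable_funM.
  apply: (measurableT_comp (measurable_normc (cmeasurable_quad_data q))).
  exact: measurable_fst.
apply: measurableT_comp => //; apply: measurable_funM => //.
by apply: measurable_funN; apply: measurable_funM.
Qed.

(** For a fixed time, independence replaces the random phases of the quadruples
    by deterministic Gaussian damping. *)
Lemma expectation_quartic_phase_le (N : nat) (t : R) : 0 < t ->
  (\int[P]_w (quartic_phase (u w) N (W t w))%:E <=
   \int[P]_w (quartic_damped (u w) N t)%:E)%E.
Proof.
move=> t0.
have mWt : measurable_fun [set: Omega] (W t) by apply: (brownian_measurable BM); exact: ltW.
have p0 : 0 <= 2 * pi :> R by rewrite mulr_ge0// pi_ge0.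
pose e (q : quad N) : R := expR (- (t * (quad_phase q)%:~R ^+ 2) / 2).
have iR (q : quad N) : P.-integrable setT (fun w => (Re (quad_coef (u w) q * expi ((quad_phase q)%:~R * W t w)))%:E).
  exact: integrable_quad_phase.
have iN (q : quad N) : P.-integrable setT (fun w => (normc (quad_coef (u w) q) * e q)%:E).
  by under eq_fun do rewrite mulrC; apply: integrableZl_EFin; exact: integrable_quad_data.
have isum (F : quad N -> Omega -> R) (Q : pred (quad N)) :
    (forall q, P.-integrable setT (fun w => (F q w)%:E)) ->
    P.-integrable setT (fun w => (2 * pi * \sum_(q | Q q) F q w)%:E).
  move=> iF; apply: integrableZl_EFin.
  by under eq_fun do rewrite -sumEFin; apply: integrable_sum => // q _; exact: iF.
pose FR (q : quad N) w := Re (quad_coef (u w) q * expi ((quad_phase q)%:~R * W t w)).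
pose FN (q : quad N) w := normc (quad_coef (u w) q) * e q.
have fin1 : (\int[P]_w (quartic_phase (u w) N (W t w))%:E)%E \is a fin_num.
  exact: integrable_fin_num (isum FR (fun q => quad_freq q == 0) iR).
have fin2 : (\int[P]_w (quartic_damped (u w) N t)%:E)%E \is a fin_num.
  exact: integrable_fin_num (isum FN (fun q => quad_freq q == 0) iN).
rewrite -(fineK fin1) -(fineK fin2) lee_fin.
have isum' (F : quad N -> Omega -> R) (Q : pred (quad N)) :
    (forall q, P.-integrable setT (fun w => (F q w)%:E)) ->
    P.-integrable setT (fun w => (\sum_(q | Q q) F q w)%:E).
  by move=> iF; under eq_fun do rewrite -sumEFin; apply: integrable_sum => // q _; exact: iF.
rewrite -[leLHS]/(\int[P]_w (2 * pi * \sum_(q | quad_freq q == 0) FR q w)).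
rewrite -[leRHS]/(\int[P]_w (2 * pi * \sum_(q | quad_freq q == 0) FN q w)).
rewrite !RintegralZl//; [|exact: isum' iN|exact: isum' iR].
apply: ler_wpM2l => //; rewrite !Rintegral_sum_EFin//.
apply: ler_sum => q _.
have [mR mI] := cmeasurable_quad_coef q.
rewrite (@expectation_phase _ _ _ _ _ BM (sigma_L2 u) (fun w => quad_coef (u w) q))//; last 4 first.
- exact: cmeasurable_quad_data.
- by move=> A mA; exact: (sigma_L2_functional mR).
- by move=> A mA; exact: (sigma_L2_functional mI).
- exact: integrable_quad_data.
rewrite -/(e q) mulrC -RintegralZr//; last first.
  apply: (@dominated_integrable_EFin _ _ _ P _ (fun w => normc (quad_coef (u w) q))).
  + by have [] := cmeasurable_quad_data q.
  + by move=> w; exact: Re_le_normc.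
  + exact: integrable_quad_data.
apply: le_Rintegral => //.
- under eq_fun do rewrite mulrC; apply: integrableZl_EFin.
  apply: (@dominated_integrable_EFin _ _ _ P _ (fun w => normc (quad_coef (u w) q))).
  + by have [] := cmeasurable_quad_data q.
  + by move=> w; exact: Re_le_normc.
  + exact: integrable_quad_data.
- exact: iN.
- move=> w _; apply: ler_wpM2r; first exact: expR_ge0.
  by rewrite (le_trans (ler_norm _))// Re_le_normc.
Qed.

End brownian.
End random_initial_data.

(** The count of quadruples produces four times the bound on the sum of the
    weights; a division by the period is left over when Bessel's inequality bounds
    the square of the energy. *)
Definition quartic_constant {R : realType} (alpha : R) : R :=
  4 * (2 + (2 * alpha - 1)^-1) / (2 * pi).

Lemma quartic_constant_ge0 {R : realType} (alpha : R) :
  2^-1 < alpha -> 0 <= quartic_constant alpha.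
Proof.
move=> a1; have k : 0 <= (2 * alpha - 1)^-1 by rewrite invr_ge0; lra.
have pi2 : 0 < 2 * pi :> R by rewrite mulr_gt0// pi_gt0.
by rewrite /quartic_constant (divr_ge0 _ (ltW pi2))// mulr_ge0// addr_ge0.
Qed.

Section time_average.
Context d (Omega : measurableType d) {R : realType} (P : probability Omega R).
Local Notation leb := (@lebesgue_measure R).
Variable u : Omega -> L2T R.
Hypothesis uL4 : in_L4L2 P u.
Variable W : R -> Omega -> R.
Hypothesis BM : is_brownian P W.
Hypothesis indep : independent_sigma P (sigma_L2 u) (sigma_process W).
Variable V : Omega * measurableTypeR R -> R.
Hypothesis mV : measurable_fun [set: (Omega * measurableTypeR R)%type] V.
Hypothesis VW : forall t, 0 < t -> {ae P, forall w, V (w, t) = W t w}.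

(** Tonelli's theorem is used twice: the phases are averaged at a fixed time, and
    the damping is then integrated over time for a fixed datum. *)
Lemma integral_quartic_phase_le (T alpha : R) N : 0 < T -> 2^-1 < alpha -> alpha <= 2 ->
  (\int[P \x lebesgue_on 0 T]_p (quartic_phase (u p.1) N (V p))%:E <=
   (quartic_constant alpha * (T + T `^ (1 - alpha / 2)))%:E *
   \int[P]_w (data_norm u w ^+ 4)%:E)%E.
Proof.
move=> T0 ha1 ha2.
have pi2 : 0 < 2 * pi :> R by rewrite mulr_gt0// pi_gt0.
pose G p := (quartic_phase (u p.1) N (V p))%:E.
have mG : measurable_fun [set: (Omega * measurableTypeR R)%type] G.
  by apply/measurable_EFinP; exact: (measurable_quartic_phase uL4 _ measurable_fst mV).
have G0 p : (0 <= G p)%E by rewrite lee_fin quartic_phase_ge0.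
pose D (p : Omega * measurableTypeR R) := (quartic_damped (u p.1) N p.2)%:E.
have mD : measurable_fun [set: (Omega * measurableTypeR R)%type] D.
  by apply/measurable_EFinP; exact: (measurable_quartic_damped uL4).
have D0 p : (0 <= D p)%E by rewrite lee_fin quartic_damped_ge0.
have mFG : measurable_fun [set: measurableTypeR R] (fubini_G P G).
  exact: (measurable_fun_fubini_tonelli_G (m1 := P) G mG G0).
have mFD : measurable_fun [set: measurableTypeR R] (fubini_G P D).
  exact: (measurable_fun_fubini_tonelli_G (m1 := P) D mD D0).
rewrite (fubini_tonelli2 G mG G0) integral_lebesgue_on_ge0; last 2 first.
- exact: mFG.
- by move=> t; apply: integral_ge0 => w _; exact: G0.
apply: (@le_trans _ _ (\int[leb]_(t in `[0%R, T]) fubini_G P D t)%E).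
  rewrite -!integral_itv_obnd_cbnd; last 2 first.
  - exact: measurable_funTS mFD.
  - exact: measurable_funTS mFG.
  apply: ge0_le_integral => //.
  - by move=> t _; apply: integral_ge0 => w _; exact: G0.
  - exact: measurable_funTS mFG.
  - exact: measurable_funTS mFD.
  - move=> t /=; rewrite in_itv/= => /andP[t0 _].
    rewrite (_ : fubini_G P G t = \int[P]_w (quartic_phase (u w) N (W t w))%:E)%E.
      exact: expectation_quartic_phase_le.
    have mWt : measurable_fun [set: Omega] (W t) by apply: (brownian_measurable BM); exact: ltW.
    apply: ae_eq_integral => //.
    + exact: measurableT_comp mG (pair2_measurable t).
    + by apply/measurable_EFinP; exact: (measurable_quartic_phase uL4 _ (@measurable_id _ _ setT) mWt).
    + by apply: filterS (VW t0) => w Vw _; rewrite /G /= Vw.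
rewrite -integral_lebesgue_on_ge0; last 2 first.
- exact: mFD.
- by move=> t; apply: integral_ge0 => w _; exact: D0.
rewrite -(fubini_tonelli (m1 := P) (m2 := lebesgue_on 0 T) D mD D0).
set C := quartic_constant alpha * _.
have C0 : 0 <= C.
  apply: mulr_ge0; first exact: quartic_constant_ge0.
  by rewrite addr_ge0 ?powR_ge0// ltW.
rewrite -ge0_integralZl_EFin//; last 2 first.
- by move=> w _; rewrite lee_fin exprn_ge0// data_norm_ge0.
- by apply/measurable_EFinP; apply: measurable_funX; exact: measurable_data_norm uL4.
apply: ge0_le_integral => //.
- by move=> w _; apply: integral_ge0 => t _; exact: D0.
- exact: (measurable_fun_fubini_tonelli_F (m2 := lebesgue_on 0 T) D mD D0).
- apply: measurable_funeM; apply/measurable_EFinP; apply: measurable_funX.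
  exact: measurable_data_norm uL4.
move=> w _; rewrite integral_lebesgue_on_ge0//; last exact: measurableT_comp mD (pair1_measurable w).
have ha : 0 <= alpha <= 2 by apply/andP; split; lra.
have hint := integral_quartic_damped_le (u w) N T0 ha.
refine (le_trans hint _).
rewrite -EFinM lee_fin.
have e0 := energy_ge0 (u w) N.
have hE : (2 * pi * energy (u w) N) ^+ 2 <= data_norm u w ^+ 4.
  rewrite (_ : data_norm u w ^+ 4 = (data_norm u w ^+ 2) ^+ 2); last by rewrite -exprM.
  rewrite ler_pXn2r ?nnegrE ?sqr_ge0//; last by apply: mulr_ge0 => //; exact: ltW.
  exact: energy_data_le.
have hS := sum_weight_le N.*2.+1 T0 ha1.
set S := \sum_(m < _) _ in hS *.
have S0 : 0 <= S by apply: sumr_ge0 => m _; exact: weight_ge0.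
have -> : 2 * pi * (4 * S * energy (u w) N ^+ 2) =
    (4 * S / (2 * pi)) * (2 * pi * energy (u w) N) ^+ 2.
  by move: (2 * pi) pi2 => q q0; field; rewrite gt_eqF.
apply: ler_pM => //.
- by apply: divr_ge0; [exact: mulr_ge0|exact: ltW].
- exact: sqr_ge0.
- rewrite /C /quartic_constant [leRHS]mulrAC ler_pM2r ?invr_gt0// -mulrA.
  by rewrite ler_wpM2l.
Qed.

End time_average.

(** * A jointly measurable version of the Brownian path *)

Section measurable_index.
Context d (X : measurableType d) {R : realType}.

(** The domain splits into the countably many level sets of the index. *)
Lemma measurable_fun_index (F : nat -> X -> R) (idx : X -> nat) :
  (forall k, measurable_fun [set: X] (F k)) ->
  (forall k, measurable [set x | idx x = k]) ->
  measurable_fun [set: X] (fun x => F (idx x) x).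
Proof.
move=> mF midx _ B mB; rewrite setTI.
have -> : (fun x => F (idx x) x) @^-1` B =
    \bigcup_k ([set x | idx x = k] `&` F k @^-1` B).
  apply/seteqP; split => x /=.
    by move=> Bx; exists (idx x).
  by move=> [k _ [/= -> ]].
apply: bigcupT_measurable => k; apply: measurableI => //.
by rewrite -[X in measurable X]setTI; exact: mF.
Qed.

Lemma cmeasurable_index (F : nat -> X -> R[i]%C) (idx : X -> nat) :
  (forall k, cmeasurable (F k)) ->
  (forall k, measurable [set x | idx x = k]) ->
  cmeasurable (fun x => F (idx x) x).
Proof.
move=> mF midx; split.
- by apply: (@measurable_fun_index (fun k x => Re (F k x))) => // k; case: (mF k).
- by apply: (@measurable_fun_index (fun k x => Im (F k x))) => // k; case: (mF k).
Qed.

Lemma measurable_truncn_eq (f : X -> R) (k : nat) :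
  measurable_fun [set: X] f -> measurable [set x | Num.truncn (f x) = k].
Proof.
move=> mf.
have lt (c : R) : measurable [set x | f x < c].
  have -> : [set x | f x < c] = f @^-1` `]-oo, c[.
    by apply/seteqP; split => x /=; rewrite in_itv.
  by rewrite -[X in measurable X]setTI; exact: mf.
have le n : measurable [set x | (Num.truncn (f x) <= n)%N].
  rewrite (_ : [set x | _] = [set x | f x < n.+1%:R]) //.
  by apply/seteqP; split => x /=; rewrite truncn_le_nat.
case: k => [|k].
  rewrite (_ : [set x | _] = [set x | (Num.truncn (f x) <= 0)%N]) //.
  by apply/seteqP; split => x /=; rewrite leqn0 => /eqP.
rewrite (_ : [set x | _] = [set x | (Num.truncn (f x) <= k.+1)%N] `\` [set x | (Num.truncn (f x) <= k)%N]).
  exact: measurableD.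
apply/seteqP; split => x /=.
  by move=> ->; rewrite leqnn; split => //; rewrite ltnn.
by move=> [h1 /negP]; rewrite -ltnNge => h2; apply/eqP; rewrite eqn_leq h1.
Qed.

End measurable_index.

Section jointly_measurable_version.
Context d (Omega : measurableType d) {R : realType}.

(** By continuity, sampling the path at the time rounded down to the grid of mesh
    [1 / n.+1] converges pointwise; each sampled process is a countable gluing of
    measurable functions. The maximum freezes the path at negative times. *)
Lemma measurable_continuous_process (Z : R -> Omega -> R) :
  (forall t, 0 <= t -> measurable_fun [set: Omega] (Z t)) ->
  (forall w, {within `[0, +oo[, continuous (Z ^~ w)}) ->
  measurable_fun [set: (Omega * measurableTypeR R)%type]
    (fun p => Z (Num.max p.2 0) p.1).
Proof.
move=> mZ cZ.
pose s (n : nat) (t : R) : R := (Num.truncn (n.+1%:R * t))%:R / n.+1%:R.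
have s0 n t : 0 <= s n t by rewrite divr_ge0.
have scvg (t : R) : s n t @[n --> \oo] --> Num.max t 0.
  have [t0|t0] := leP t 0.
    apply: cvg_near_cst; apply: nearW => n.
    rewrite /s (_ : Num.truncn _ = 0%N) ?mul0r//.
    by apply/eqP; rewrite -leqn0 truncn_le_nat (le_lt_trans _ (ltr01))// mulr_ge0_le0.
  apply: (@squeeze_cvgr _ _ _ _ (fun n => t - harmonic n) (fun=> t)).
  - near=> n.
    have n0 : 0 < n.+1%:R :> R by rewrite ltr0n.
    have /andP[h1 h2] : (Num.truncn (n.+1%:R * t))%:R <= n.+1%:R * t < (Num.truncn (n.+1%:R * t)).+1%:R.
      by apply: truncn_itv; rewrite mulr_ge0// ltW.
    rewrite /s /harmonic /= ler_pdivrMr// [t * _]mulrC h1 andbT.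
    rewrite ler_pdivlMr// mulrBl mulVf ?gt_eqF// lerBlDr.
    by rewrite natr1 mulrC ltW.
  - by rewrite -[X in _ --> X]subr0; apply: cvgB; [exact: cvg_cst|exact: cvg_harmonic].
  - exact: cvg_cst.
pose h n (p : Omega * measurableTypeR R) := Z (s n p.2) p.1.
have mh n : measurable_fun [set: (Omega * measurableTypeR R)%type] (h n).
  apply: (@measurable_fun_index _ (Omega * measurableTypeR R)%type _
    (fun k p => Z (k%:R / n.+1%:R) p.1) (fun p => Num.truncn (n.+1%:R * p.2))).
  - move=> k; apply: (measurableT_comp (mZ _ _) measurable_fst).
    by rewrite divr_ge0.
  - by move=> k; apply: measurable_truncn_eq; apply: measurable_funM.
apply: (measurable_fun_cvg mh) => p _.
have := cZ p.1; move=> /subspace_continuousP.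
have m0 : `[0, +oo[%classic (Num.max p.2 0) by rewrite /= in_itv/= andbT le_max lexx orbT.
move=> /(_ _ m0) cp.
apply: (cvg_comp (fun n => s n p.2) (Z ^~ p.1) _ cp).
move=> A nA.
have H : \forall n \near \oo, `[0, +oo[%classic (s n p.2) -> A (s n p.2) := scvg p.2 _ nA.
change (\forall n \near \oo, A (s n p.2)).
by apply: filterS H => n; apply; rewrite /= in_itv/= andbT.
Unshelve. all: end_near. Qed.

Variable P : probability Omega R.

(** The version is [W], except on a null set that contains the discontinuous
    paths, where it vanishes; at negative times it keeps the value at time 0. *)
Lemma brownian_jointly_measurable (W : R -> Omega -> R) : is_brownian P W ->
  exists V : Omega * measurableTypeR R -> R,
    measurable_fun [set: (Omega * measurableTypeR R)%type] V /\
    exists A : set Omega, [/\ measurable A, P A = 0 &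
      forall w t, ~ A w -> 0 <= t -> V (w, t) = W t w].
Proof.
move=> BM; have [A [mA PA0 cA]] := brownian_continuous BM.
pose Z (t : R) (w : Omega) : R := \1_(~` A) w * W t w.
exists (fun p => Z (Num.max p.2 0) p.1); split.
  apply: measurable_continuous_process => [t t0|w].
    apply: measurable_funM; last exact: brownian_measurable BM t t0.
    by apply: measurable_indic; exact: measurableC.
  have [Aw|nAw] := pselect (A w).
    rewrite (_ : Z ^~ w = cst 0); first by apply: continuous_subspaceT => x; exact: cvg_cst.
    by apply/funext => t; rewrite /Z indicE memNset ?mul0r//= => /(_ Aw).
  rewrite (_ : Z ^~ w = W ^~ w); last first.
    by apply/funext => t; rewrite /Z indicE mem_set ?mul1r.
  by apply: contrapT => nc; apply: nAw; apply: cA.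
exists A; split => // w t nAw t0 /=.
by rewrite /Z indicE mem_set// mul1r max_l.
Qed.

End jointly_measurable_version.

(** * Lower semicontinuity of the fourth power *)

Section lower_semicontinuity.
Context {R : realType}.
Local Notation mu := (@torus_measure R).
Implicit Types (g : measurableTypeR R -> R[i]%C).

Lemma limn_einf_ge (a : (\bar R)^nat) (c : \bar R) :
  (\forall n \near \oo, (c <= a n)%E) -> (c <= limn_einf a)%E.
Proof.
move=> [N _ ca]; rewrite limn_einf_lim (cvg_lim _ (@cvg_einfs_sup _ a))//.
apply: le_trans (ereal_sup_ubound _); last by exists N.
by apply: le_ereal_inf_tmp => _ [n /= Nn <-]; exact: ca.
Qed.

(** Truncating at height [M] makes the fourth power Lipschitz; Young's inequality
    then trades the linear error for a small constant and a multiple of its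
    square, which is what convergence in [L^2] controls. *)
Lemma pow4_min_le (M e a b h : R) : 0 < M -> 0 < e -> 0 <= a -> 0 <= b -> 0 <= h ->
  a <= b + h ->
  Num.min a M ^+ 4 <= b ^+ 4 + e + (15 * M ^+ 3) ^+ 2 / (4 * e) * h ^+ 2.
Proof.
move=> M0 e0 a0 b0 h0 abh.
set b' := Num.min b M; set h' := Num.min h M; set c := Num.min a M.
have b'0 : 0 <= b' by rewrite le_min b0 ltW.
have h'0 : 0 <= h' by rewrite le_min h0 ltW.
have c0 : 0 <= c by rewrite le_min a0 ltW.
have b'M : b' <= M by rewrite ge_min lexx orbT.
have h'M : h' <= M by rewrite ge_min lexx orbT.
have b'b : b' <= b by rewrite ge_min lexx.
have h'h : h' <= h by rewrite ge_min lexx.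
have cbh : c <= b' + h'.
  rewrite /c /b' /h'; case: (leP b M) => bM; case: (leP h M) => hM.
  - by rewrite ge_min abh.
  - by rewrite ge_min lerDr b0 orbT.
  - by rewrite ge_min lerDl h0 orbT.
  - by rewrite ge_min lerDl (ltW M0) orbT.
have c4 : c ^+ 4 <= (b' + h') ^+ 4 by rewrite ler_pXn2r// nnegrE addr_ge0.
have b4 : b' ^+ 4 <= b ^+ 4 by rewrite ler_pXn2r// nnegrE.
have h2 : h' ^+ 2 <= h ^+ 2 by rewrite ler_pXn2r// nnegrE.
have M3 : 0 <= M ^+ 3 by rewrite exprn_ge0// ltW.
set s := b' + h' in c4 *; have s0 : 0 <= s by rewrite addr_ge0.
have s2M : s <= 2 * M by rewrite /s; lra.
have k1 : s ^+ 3 <= 8 * M ^+ 3.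
  have -> : 8 * M ^+ 3 = (2 * M) ^+ 3 by ring.
  by rewrite ler_pXn2r// nnegrE mulr_ge0// ltW.
have k2 : s ^+ 2 * b' <= 4 * M ^+ 3.
  have -> : 4 * M ^+ 3 = (2 * M) ^+ 2 * M by ring.
  by apply: ler_pM => //; rewrite ?sqr_ge0// ler_pXn2r// nnegrE mulr_ge0// ltW.
have k3 : s * b' ^+ 2 <= 2 * M ^+ 3.
  have -> : 2 * M ^+ 3 = (2 * M) * M ^+ 2 by ring.
  by apply: ler_pM => //; rewrite ?sqr_ge0// ler_pXn2r// nnegrE ltW.
have k4 : b' ^+ 3 <= M ^+ 3 by rewrite ler_pXn2r// nnegrE ltW.
(* The constant is 8 + 4 + 2 + 1, from the factorization of [s^4 - b'^4]. *)
have lip : s ^+ 4 - b' ^+ 4 <= 15 * M ^+ 3 * h'.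
  have -> : s ^+ 4 - b' ^+ 4 = (s ^+ 3 + s ^+ 2 * b' + s * b' ^+ 2 + b' ^+ 3) * h'.
    by rewrite /s; ring.
  by rewrite ler_wpM2r//; lra.
set K := 15 * M ^+ 3 in lip *.
have young : K * h' <= e + K ^+ 2 / (4 * e) * h' ^+ 2.
  have -> : e + K ^+ 2 / (4 * e) * h' ^+ 2 = K * h' + (K * h' - 2 * e) ^+ 2 / (4 * e).
    by field; rewrite gt_eqF.
  by rewrite lerDl divr_ge0 ?sqr_ge0// mulr_ge0// ltW.
have : K ^+ 2 / (4 * e) * h' ^+ 2 <= K ^+ 2 / (4 * e) * h ^+ 2.
  by rewrite ler_wpM2l// divr_ge0 ?sqr_ge0// mulr_ge0// ltW.
move: lip young c4 b4; lra.
Qed.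

Let measurable_min_pow4 g (M : R) : cmeasurable g ->
  measurable_fun [set: measurableTypeR R] (fun x => (Num.min (normc (g x)) M ^+ 4)%:E).
Proof.
move=> mg; apply/measurable_EFinP; apply: measurable_funX.
by apply: measurable_minr => //; exact: measurable_normc.
Qed.

Let measurable_pow g n : cmeasurable g ->
  measurable_fun [set: measurableTypeR R] (fun x => (normc (g x) ^+ n)%:E).
Proof.
by move=> mg; apply/measurable_EFinP; apply: measurable_funX; exact: measurable_normc.
Qed.

Let pi2_gt0 : 0 < 2 * pi :> R. Proof. by rewrite mulr_gt0// pi_gt0. Qed.

Let torusT : mu setT = (2 * pi)%:E.
Proof. by rewrite /= lebesgue_onT ?subr0// ltW. Qed.

Lemma integral_pow4_min_le g (gN : nat -> measurableTypeR R -> R[i]%C) (M : R) :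
  0 < M -> cmeasurable g -> (forall n, cmeasurable (gN n)) ->
  sqr_mass (fun x => g x - gN n x) @[n --> \oo] --> 0%E ->
  (\int[mu]_x (Num.min (normc (g x)) M ^+ 4)%:E <=
   limn_einf (fun n => \int[mu]_x (normc (gN n x) ^+ 4)%:E))%E.
Proof.
move=> M0 mg mgN cv; apply/lee_addgt0Pr => eta eta0.
rewrite -leeBlDr//.
apply: limn_einf_ge.
pose e := eta / (4 * pi).
have pi0 : 0 < pi :> R by exact: pi_gt0.
have e0 : 0 < e by rewrite divr_gt0// mulr_gt0.
pose K := (15 * M ^+ 3) ^+ 2 / (4 * e).
have K0 : 0 <= K by rewrite divr_ge0 ?sqr_ge0// mulr_ge0// ltW.
have : \forall n \near \oo, (sqr_mass (fun x => g x - gN n x)%R < (eta / (2 * (K + 1)))%:E)%E.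
  have pos : 0 < eta / (2 * (K + 1)).
    by rewrite divr_gt0// mulr_gt0// ltr_wpDl.
  move/fine_cvgP : cv => [fin /cvgrPdist_lt /(_ _ pos) near0].
  near=> n.
  have fn : sqr_mass (fun x => g x - gN n x) \is a fin_num by near: n.
  rewrite -(fineK fn) lte_fin.
  have : `|0 - fine (sqr_mass (fun x => g x - gN n x))| < eta / (2 * (K + 1)) by near: n.
  by rewrite sub0r normrN; apply: le_lt_trans; exact: ler_norm.
apply: filterS => n hn.
have mB := cmeasurableB mg (mgN n).
rewrite leeBlDr//.
apply: (@le_trans _ _ (\int[mu]_x (normc (gN n x) ^+ 4)%:E +
    \int[mu]_x (cst e%:E x) + K%:E * sqr_mass (fun x => g x - gN n x)%R)%E).
  rewrite -ge0_integralZl_EFin//; last 2 first.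
  - by move=> x _; rewrite lee_fin sqr_ge0.
  - exact: measurable_pow.
  rewrite -ge0_integralD//; last 3 first.
  - by move=> x _; rewrite lee_fin exprn_ge0// normc_ge0.
  - exact: measurable_pow.
  - by move=> x _; rewrite lee_fin ltW.
  rewrite -ge0_integralD//; last 4 first.
  - by move=> x _; rewrite -EFinD lee_fin addr_ge0 ?(ltW e0)// exprn_ge0// normc_ge0.
  - by apply: emeasurable_funD => //; exact: measurable_pow.
  - by move=> x _; rewrite mule_ge0// lee_fin ?sqr_ge0.
  - by apply: measurable_funeM; exact: measurable_pow.
  apply: ge0_le_integral => //.
  - by move=> x _; rewrite lee_fin exprn_ge0// le_min normc_ge0 ltW.
  - exact: measurable_min_pow4.
  - apply: emeasurable_funD; last by apply: measurable_funeM; exact: measurable_pow.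
    by apply: emeasurable_funD => //; exact: measurable_pow.
  - move=> x _; rewrite -EFinM -!EFinD lee_fin.
    apply: pow4_min_le; rewrite ?normc_ge0//.
    by rewrite (le_trans _ (le_normcD _ _))// addrC subrK.
rewrite integral_cst// torusT -addeA leeD2l//.
apply: (@le_trans _ _ ((e * (2 * pi))%:E + (K * (eta / (2 * (K + 1))))%:E)%E).
  by rewrite leeD// !EFinM lee_wpmul2l ?lee_fin// ltW.
rewrite -EFinD lee_fin.
have -> : e * (2 * pi) = eta / 2 by rewrite /e; move: (@pi R) pi0 => q q0; field; rewrite gt_eqF.
have -> : K * (eta / (2 * (K + 1))) = eta / 2 * (K / (K + 1)).
  by field; rewrite gt_eqF// ltr_wpDl.
have : eta / 2 * (K / (K + 1)) <= eta / 2 * 1.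
  apply: ler_wpM2l; first by rewrite divr_ge0// ltW.
  by rewrite ler_pdivrMr ?mul1r ?lerDl// ltr_wpDl.
lra.
Unshelve. all: end_near. Qed.

(** By monotone convergence it suffices to bound the truncated fourth powers. *)
Lemma quartic_mass_lsc g (gN : nat -> measurableTypeR R -> R[i]%C) :
  cmeasurable g -> (forall n, cmeasurable (gN n)) ->
  sqr_mass (fun x => g x - gN n x) @[n --> \oo] --> 0%E ->
  (\int[mu]_x (normc (g x) ^+ 4)%:E <=
   limn_einf (fun n => \int[mu]_x (normc (gN n x) ^+ 4)%:E))%E.
Proof.
move=> mg mgN cv.
pose h (m : nat) x := (Num.min (normc (g x)) m.+1%:R ^+ 4)%:E.
have hcv x : h m x @[m --> \oo] --> (normc (g x) ^+ 4)%:E.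
  apply: cvg_near_cst; near=> m; rewrite /h min_l//.
  rewrite (le_trans (ltW (truncnS_gt _)))// ler_nat ltnS.
  by near: m; exact: nbhs_infty_ge.
have -> : (\int[mu]_x (normc (g x) ^+ 4)%:E = \int[mu]_x limn (h ^~ x))%E.
  by apply: eq_integral => x _; apply/esym/cvg_lim.
rewrite monotone_convergence//; last 3 first.
- by move=> m; exact: measurable_min_pow4.
- by move=> m x _; rewrite lee_fin exprn_ge0// le_min normc_ge0/=.
- move=> x _ m n mn; rewrite lee_fin ler_pXn2r ?nnegrE ?le_min ?normc_ge0//=.
  by rewrite ge_min lexx/= ge_min ler_nat ltnS mn orbT.
apply: lime_le.
  apply: ereal_nondecreasing_is_cvgn => m n mn; apply: ge0_le_integral => //.
  - by move=> x _; rewrite lee_fin exprn_ge0// le_min normc_ge0/=.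
  - exact: measurable_min_pow4.
  - exact: measurable_min_pow4.
  - move=> x _; rewrite lee_fin ler_pXn2r ?nnegrE ?le_min ?normc_ge0//=.
    by rewrite ge_min lexx/= ge_min ler_nat ltnS mn orbT.
by near=> m; apply: integral_pow4_min_le.
Unshelve. all: end_near. Qed.

End lower_semicontinuity.

(** * A measurable representative of the evolution *)

Section truncations.
Context {R : realType}.
Local Open Scope complex_scope.
Implicit Types (f : measurableTypeR R -> R[i]) (s : R) (M N : nat).

(** Truncations of different lengths number the same frequency differently;
    this puts them on a common index set. *)
Lemma sum_freq_widen (V : nmodType) (F : int -> V) N M : (N <= M)%N ->
  \sum_(j < N.*2.+1) F (freq j) =
  \sum_(j < M.*2.+1 | (M - N <= j <= M + N)%N) F (freq j).
Proof.
move=> NM.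
have lt (j : 'I_(N.*2.+1)) : (j + (M - N) < M.*2.+1)%N.
  by have := ltn_ord j; rewrite !ltnS; lia.
rewrite (reindex_onto (fun j : 'I_(N.*2.+1) => Ordinal (lt j))
  (fun i : 'I_(M.*2.+1) => inord (i - (M - N)))) /=; last first.
  move=> i /andP[h1 h2]; apply: val_inj => /=.
  by rewrite inordK ?subnK// ltnS; lia.
apply: eq_big => [j|j _]; last by congr F; rewrite /freq /=; lia.
apply/esym; apply/andP; split.
  by have := ltn_ord j; rewrite ltnS => ?; apply/andP; split; lia.
by apply/eqP/val_inj; rewrite /= inordK addnK.
Qed.

Lemma energyB f N M : (N <= M)%N -> energy f M - energy f N =
  \sum_(j < M.*2.+1 | ~~ (M - N <= j <= M + N)%N) normc (fourier_coef f (freq j)) ^+ 2.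
Proof.
move=> NM; rewrite [energy f N](sum_freq_widen (fun k => normc (fourier_coef f k) ^+ 2) NM).
rewrite /energy (bigID (fun j : 'I_(M.*2.+1) => (M - N <= j <= M + N)%N)) /=.
by rewrite addrAC subrr add0r.
Qed.

Lemma energy_nondecreasing f : {homo energy f : N M / (N <= M)%N >-> N <= M}.
Proof.
by move=> N M NM; rewrite -subr_ge0 energyB// sumr_ge0// => j _; exact: sqr_ge0.
Qed.

(** The phases have modulus one, so Parseval's identity does not see them. *)
Lemma sqr_mass_partial_sumB s f N M :
  sqr_mass (fun x => evolution_partial_sum s f M x - evolution_partial_sum s f N x) =
  (2 * pi * `|energy f M - energy f N|)%:E.
Proof.
wlog NM : N M / (N <= M)%N.
  move=> H; have [/H//|/ltnW/H] := leqP N M.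
  by rewrite sqr_massBC distrC.
rewrite ger0_norm ?subr_ge0 ?energy_nondecreasing// energyB//.
pose c (j : 'I_(M.*2.+1)) := if (M - N <= j <= M + N)%N then 0 else
    fourier_coef f (freq j) * expi ((freq j ^+ 2)%:~R * s).
rewrite (_ : (fun x => _) = trig_poly c (@freq M)); last first.
  apply/funext => x; rewrite !evolution_partial_sumE /trig_poly.
  rewrite [X in _ - X](sum_freq_widen (fun k => fourier_coef f k * expi ((k ^+ 2)%:~R * s) *
    expi (k%:~R * x)) NM).
  rewrite (bigID (fun j : 'I_(M.*2.+1) => (M - N <= j <= M + N)%N)) /= addrAC subrr add0r.
  rewrite big_mkcond; apply: eq_bigr => j _; rewrite /c.
  by case: (M - N <= j <= M + N)%N; rewrite /= ?mul0r.
rewrite sqr_mass_trig_poly; last exact: freq_inj.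
congr (_ * _)%:E; rewrite [RHS]big_mkcond; apply: eq_bigr => j _.
rewrite /c; case: (M - N <= j <= M + N)%N; first by rewrite ComplexField.Normc.normc0 expr0n.
move: (fourier_coef f (freq j)) => a.
by rewrite normcM normc_expi mulr1.
Qed.

End truncations.

Section pointwise_limit.
Context {R : realType}.
Local Open Scope complex_scope.
Local Notation mu := (@torus_measure R).

(** Upper limits are defined everywhere and measurable in any parameter; this is
    the limit wherever the sequence converges. *)
Definition pointwise_limit (X : Type) (h : nat -> X -> R[i]) (x : X) : R[i] :=
  fine (limn_esup (fun j => (Re (h j x))%:E)) +i*
  fine (limn_esup (fun j => (Im (h j x))%:E)).

Lemma cmeasurable_pointwise_limit d (X : measurableType d) (h : nat -> X -> R[i]) :
  (forall j, cmeasurable (h j)) -> cmeasurable (pointwise_limit h).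
Proof.
move=> mh; split; apply: (measurableT_comp (@fine_measurable R setT measurableT));
  apply: measurable_fun_limn_esup => // j; apply/measurable_EFinP; by case: (mh j).
Qed.

Lemma fine_limn_esup (a : nat -> R) : cvgn a ->
  a @ \oo --> fine (limn_esup (EFin \o a)).
Proof.
move=> ca; have cE : (EFin \o a) @ \oo --> (limn a)%:E by exact/cvg_EFin/ca/nearW.
by rewrite (cvg_limn_einf_sup cE).2.
Qed.

Lemma pointwise_limitP (X : Type) (h : nat -> X -> R[i]) x :
  cvgn (fun j => Re (h j x)) -> cvgn (fun j => Im (h j x)) ->
  (Re (h j x) @[j --> \oo] --> Re (pointwise_limit h x)) /\
  (Im (h j x) @[j --> \oo] --> Im (pointwise_limit h x)).
Proof. by move=> cR cI; split; exact: fine_limn_esup. Qed.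

(** Absolute convergence of the telescoping series. *)
Lemma cvgn_summable_increments (a b : nat -> R) :
  (forall j, `|a j.+1 - a j| <= b j) -> (\sum_(j <oo) (b j)%:E < +oo)%E -> cvgn a.
Proof.
move=> ab boo.
have b0 j : 0 <= b j by rewrite (le_trans _ (ab j)).
have cb : cvgn (series b).
  apply: nondecreasing_is_cvgn; first exact: nondecreasing_series.
  exists (fine (\sum_(j <oo) (b j)%:E)%E) => _ [n _ <-].
  rewrite -lee_fin fineK; last first.
    by rewrite ge0_fin_numE// nneseries_ge0// => j _ _; rewrite lee_fin.
  rewrite /series /= -sumEFin; apply: nneseries_lim_ge => j _ _.
  by rewrite lee_fin.
have : cvgn (series (telescope a)).
  by apply: normed_cvg; apply: series_le_cvg cb => // n; exact: normr_ge0.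
rewrite telescopeK => cv.
have -> : a = (fun n => (a n - a 0%N) + a 0%N) by apply/funext => n; rewrite subrK.
by apply: is_cvgD => //; exact: is_cvg_cst.
Qed.

Let pi2_gt0 : 0 < 2 * pi :> R. Proof. by rewrite mulr_gt0// pi_gt0. Qed.

(** Geometric decay in [L^2] makes the total variation of the sequence integrable,
    hence finite almost everywhere. *)
Lemma fast_cauchy_ae (h : nat -> measurableTypeR R -> R[i]) :
  (forall j, cmeasurable (h j)) ->
  (forall j, (sqr_mass (fun x => h j.+1 x - h j x)%R <=
    (2 * pi * (2 ^+ j)^-1 ^+ 2)%:E)%E) ->
  {ae mu, forall x,
    (Re (h j x) @[j --> \oo] --> Re (pointwise_limit h x)) /\
    (Im (h j x) @[j --> \oo] --> Im (pointwise_limit h x))}.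
Proof.
move=> mh hh.
pose f j x := (normc (h j.+1 x - h j x))%:E.
have mB j : cmeasurable (fun x => h j.+1 x - h j x) by exact: cmeasurableB.
have mf j : measurable_fun [set: measurableTypeR R] (f j).
  by apply/measurable_EFinP; exact: measurable_normc.
have f0 j x : (0 <= f j x)%E by rewrite lee_fin normc_ge0.
have fle j : (\int[mu]_x f j x <= (8 * pi / (2 ^ (j + 1))%:R)%:E)%E.
  have c0 : 0 < 2 ^+ j :> R by rewrite exprn_gt0.
  (* The modulus [a] of the increment is at most [c^-1 + c a^2] for [c = 2^j];
     on average, each of these terms is at most [2^-j]. *)
  apply: (@le_trans _ _ (\int[mu]_x (cst ((2 ^+ j)^-1)%:E x +
      (2 ^+ j)%:E * (normc (h j.+1 x - h j x) ^+ 2)%:E))%E).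
    apply: ge0_le_integral => //.
    - apply: emeasurable_funD => //; apply: measurable_funeM.
      by apply/measurable_EFinP; apply: measurable_funX; exact: measurable_normc.
    - move=> x _; rewrite /f -EFinM -EFinD lee_fin.
      set a := normc _; set c : R := 2 ^+ j in c0 *.
      have a0 : 0 <= a by exact: normc_ge0.
      have -> : c^-1 + c * a ^+ 2 = a + ((c * a - 2^-1) ^+ 2 + 3 / 4) / c.
        by field; rewrite gt_eqF.
      by rewrite lerDl (divr_ge0 _ (ltW c0))// addr_ge0// sqr_ge0.
  rewrite ge0_integralD//; last 3 first.
  - by move=> x _; rewrite lee_fin invr_ge0 ltW.
  - by move=> x _; rewrite -EFinM lee_fin mulr_ge0 ?sqr_ge0// ltW.
  - apply: measurable_funeM.
    by apply/measurable_EFinP; apply: measurable_funX; exact: measurable_normc.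
  rewrite integral_cst// [X in (_ * X + _)%E](_ : _ = (2 * pi)%:E); last first.
    by rewrite /= lebesgue_onT ?subr0// ltW.
  rewrite ge0_integralZl_EFin//; last 2 first.
  - by move=> x _; rewrite lee_fin sqr_ge0.
  - by apply/measurable_EFinP; apply: measurable_funX; exact: measurable_normc.
  apply: (@le_trans _ _ ((2 ^+ j)^-1%:E * (2 * pi)%:E +
      (2 ^+ j)%:E * (2 * pi * (2 ^+ j)^-1 ^+ 2)%:E)%E).
    by apply/leeD2l/lee_wpmul2l; [rewrite lee_fin ltW|exact: hh].
  rewrite -!EFinM -EFinD lee_fin addn1 natrX [_ ^+ j.+1]exprS.
  set c : R := 2 ^+ j in c0 *; move: (@pi R) => q.
  by rewrite le_eqVlt; apply/orP; left; apply/eqP; field; rewrite gt_eqF.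
have fint : mu.-integrable setT (fun x => \sum_(j <oo) f j x)%E.
  apply/integrableP; split.
    by apply: ge0_emeasurable_sum => // k x _ _.
  under eq_integral do rewrite gee0_abs ?nneseries_ge0//.
  rewrite integral_nneseries//.
  apply: (@le_lt_trans _ _ (\sum_(j <oo) (8 * pi / (2 ^ (j + 1))%:R)%:E)%E).
    by apply: lee_nneseries => // j _ _; exact: integral_ge0.
  by rewrite (cvg_lim _ (@cvg_geometric_eseries_half R (8 * pi) 0))// ltry.
have := integrable_ae measurableT fint.
apply: filterS => x /(_ I) fx.
have foo : (\sum_(j <oo) f j x < +oo)%E by rewrite ltey_eq fx.
apply: pointwise_limitP.
- apply: (cvgn_summable_increments (b := fun j => normc (h j.+1 x - h j x))) => // j.
  by rewrite -ReN -ReD Re_le_normc.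
- apply: (cvgn_summable_increments (b := fun j => normc (h j.+1 x - h j x))) => // j.
  by rewrite -ImN -ImD Im_le_normc.
Qed.

End pointwise_limit.

Section free_evolution_limit.
Context {R : realType}.
Local Open Scope complex_scope.
Local Notation mu := (@torus_measure R).
Implicit Types (f g : measurableTypeR R -> R[i]) (s : R) (N : nat).

Let pi2_ge0 : 0 <= 2 * pi :> R. Proof. by rewrite mulr_ge0// pi_ge0. Qed.

Lemma evolution_partial_sum_periodic s f N (x : R) :
  evolution_partial_sum s f N (x + 2 * pi) = evolution_partial_sum s f N x.
Proof.
rewrite !evolution_partial_sumE; apply: eq_bigr => j _; congr (_ * _).
by rewrite mulrDr expiD expi_2piz mulr1.
Qed.

Lemma cmeasurable_evolution_partial_sum s f N :
  @cmeasurable R _ (measurableTypeR R) (evolution_partial_sum s f N).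
Proof. by rewrite evolution_partial_sumE; exact: cmeasurable_trig_poly. Qed.

(** The integrands converge almost everywhere along the sequence, and Fatou's
    lemma applies. *)
Lemma sqr_mass_pointwise_limit_le (h : nat -> measurableTypeR R -> R[i]) g
    (a : nat -> R) (l : R) :
  (forall j, cmeasurable (h j)) -> cmeasurable g ->
  (forall j, (sqr_mass (fun x => h j.+1 x - h j x)%R <=
    (2 * pi * (2 ^+ j)^-1 ^+ 2)%:E)%E) ->
  (forall j, sqr_mass (fun x => h j x - g x) = (a j)%:E) ->
  a @ \oo --> l ->
  (sqr_mass (fun x => pointwise_limit h x - g x)%R <= l%:E)%E.
Proof.
move=> mh mg hh ha al.
have m2 (k : measurableTypeR R -> R[i]) : cmeasurable k ->
    measurable_fun [set: measurableTypeR R] (fun x => (normc (k x - g x) ^+ 2)%:E).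
  move=> mk; apply/measurable_EFinP; apply: measurable_funX.
  by apply: measurable_normc; exact: cmeasurableB.
pose F j x := (normc (h j x - g x) ^+ 2)%:E.
have mF j : measurable_fun [set: measurableTypeR R] (F j) by exact: m2.
have F0 j x : (0 <= F j x)%E by rewrite lee_fin sqr_ge0.
have cvF := fast_cauchy_ae mh hh.
have -> : l%:E = limn_einf (fun j => (a j)%:E).
  apply/esym; apply: (cvg_limn_einf_sup _).1.
  by apply: cvg_EFin => //; exact: nearW.
have -> : (fun j => (a j)%:E) = (fun j => \int[mu]_x F j x)%E.
  by apply/funext => j; rewrite -ha.
apply: le_trans (fatou mu measurableT mF (fun j x _ => F0 j x)).
have mlim : measurable_fun [set: measurableTypeR R] (fun x => limn_einf (F ^~ x)).
  rewrite /limn_einf; apply: measurableT_comp => //.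
  by apply: measurable_fun_limn_esup => j; exact: measurableT_comp.
have lim0 x : (0 <= limn_einf (F ^~ x))%E by apply: limn_einf_ge; exact: nearW.
apply: ae_ge0_le_integral => //.
- by move=> x _; rewrite lee_fin sqr_ge0.
- by apply: m2; exact: cmeasurable_pointwise_limit.
apply: filterS cvF => x [cR cI] _.
rewrite le_eqVlt; apply/orP; left; apply/eqP/esym; apply: (cvg_limn_einf_sup _).1.
apply: cvg_EFin; first exact: nearW.
rewrite /comp /= sqr_normc.
under eq_fun do rewrite sqr_normc !ReD !ReN !ImD !ImN.
rewrite ReD ReN ImD ImN.
apply: cvgD; rewrite !expr2.
- by apply: cvgM; apply: cvgB => //; exact: cvg_cst.
- by apply: cvgM; apply: cvgB => //; exact: cvg_cst.
Qed.

(** The truncations have increments measured by the energy, so that a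
    subsequence along which the energy converges geometrically fast converges
    almost everywhere, to a representative of the limit in [L^2]. *)
Lemma is_free_evolution_pointwise_limit s f (idx : nat -> nat) (l : R) :
  energy f @ \oo --> l ->
  (forall j, `|l - energy f (idx j)| <= 2^-1 * (2 ^+ j)^-1 ^+ 2) ->
  is_free_evolution s f
    (pointwise_limit (fun j => evolution_partial_sum s f (idx j))).
Proof.
move=> el hidx.
pose h j := evolution_partial_sum s f (idx j).
have mh j : cmeasurable (h j) by exact: cmeasurable_evolution_partial_sum.
have mv : cmeasurable (pointwise_limit h) by exact: cmeasurable_pointwise_limit.
have hh j : (sqr_mass (fun x => h j.+1 x - h j x)%R <=
    (2 * pi * (2 ^+ j)^-1 ^+ 2)%:E)%E.
  rewrite sqr_mass_partial_sumB lee_fin ler_wpM2l//.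
  have c0 : 0 <= (2 ^+ j)^-1 ^+ 2 :> R by exact: sqr_ge0.
  have := hidx j; have := hidx j.+1.
  have -> : (2 ^+ j.+1)^-1 ^+ 2 = (2 ^+ j)^-1 ^+ 2 / 4 :> R.
    by rewrite [2 ^+ j.+1]exprS; field; rewrite expf_neq0.
  move=> h1 h2.
  have -> : energy f (idx j.+1) - energy f (idx j) =
    (l - energy f (idx j)) - (l - energy f (idx j.+1)) by ring.
  by rewrite (le_trans (ler_normB _ _))//; lra.
have lN N : (sqr_mass (fun x => pointwise_limit h x - evolution_partial_sum s f N x)%R <=
    (2 * pi * `|l - energy f N|)%:E)%E.
  apply: (sqr_mass_pointwise_limit_le (a := fun j => 2 * pi * `|energy f (idx j) - energy f N|)) => //.
  - exact: cmeasurable_evolution_partial_sum.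
  - by move=> j; exact: sqr_mass_partial_sumB.
  apply: cvgMr; apply: cvg_norm; apply: cvgB; last exact: cvg_cst.
  apply/cvgrPdist_le => e e0.
  have : (fun j => geometric 1 2^-1 j) @ \oo --> (0 : R).
    by apply: cvg_geometric; rewrite ger0_norm// invf_lt1// ltr1n.
  move=> /cvgrPdist_le /(_ e e0); apply: filterS => j; rewrite /geometric /= mul1r.
  rewrite sub0r normrN ger0_norm ?exprn_ge0// => hj.
  rewrite (le_trans (hidx j))// (le_trans _ hj)//.
  rewrite (_ : 2^-1 ^+ j = (2 ^+ j)^-1 :> R); last by rewrite exprVn.
  set c := (2 ^+ j)^-1 : R.
  have c0 : 0 <= c by rewrite invr_ge0 exprn_ge0.
  have c1 : c <= 1 by rewrite invf_le1 ?exprn_gt0// exprn_ege1// ler1n.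
  nra.
have L20 : square_integrable (pointwise_limit h).
  split => //.
  pose S0 := evolution_partial_sum s f 0.
  have mS0 : cmeasurable S0 by exact: cmeasurable_evolution_partial_sum.
  rewrite (_ : pointwise_limit h = (fun x => (pointwise_limit h x - S0 x) + S0 x)); last first.
    by apply/funext => x; rewrite subrK.
  rewrite (le_lt_trans (sqr_massD_le (cmeasurableB mv mS0) mS0))//.
  rewrite lte_add_pinfty// lte_mul_pinfty//.
    by rewrite (le_lt_trans (lN 0%N))// ltry.
  rewrite /S0 evolution_partial_sumE.
  by case: (square_integrable_trig_poly (fun j : 'I_(0.*2.+1) =>
    fourier_coef f (freq j) * expi ((freq j ^+ 2)%:~R * s)) (@freq 0)).
split; first split => //.
- move=> x; rewrite /pointwise_limit.
  by under [in LHS]eq_fun do rewrite evolution_partial_sum_periodic;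
     under [X in _ +i* fine (limn_esup X) = _]eq_fun do rewrite evolution_partial_sum_periodic.
- by rewrite L2norm_sqr_mass poweR_lty//; case: L20.
have d0 : 2 * pi * `|l - energy f N| @[N --> \oo] --> (0 : R).
  rewrite -[X in _ --> X](mulr0 (2 * pi)).
  apply: cvgMr; rewrite -(@normr0 _ R) -(subrr l).
  by apply: cvg_norm; apply: cvgB => //; exact: cvg_cst.
apply: (@squeeze_cvge _ _ _ _ (cst 0%E) _ (fun N => (Num.sqrt (2 * pi * `|l - energy f N|))%:E)).
- apply: nearW => N; rewrite /= Lnorm_ge0/= L2norm_sqr_mass.
  rewrite -powR12_sqrt; last by rewrite mulr_ge0.
  rewrite -poweR_EFin.
  apply: le_poweR => //; exact: sqr_mass_ge0.
- exact: cvg_cst.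
- apply: cvg_EFin; first exact: nearW.
  rewrite -[X in _ --> X]sqrtr0.
  apply: (cvg_comp (fun N => 2 * pi * `|l - energy f N|) (@Num.sqrt R) _ (@sqrt_continuous R 0)).
  exact: d0.
Qed.

End free_evolution_limit.

Section first_index.
Context d (X : measurableType d).

Lemma measurable_first_index (A : nat -> set X) :
  (forall x, exists k, A k x) -> (forall k, measurable (A k)) ->
  exists idx : X -> nat, (forall x, A (idx x) x) /\
    (forall k, measurable [set x | idx x = k]).
Proof.
move=> exA mA.
have exb x : exists k, (fun k => `[< A k x >]) k.
  by have [k Ak] := exA x; exists k; exact/asboolP.
exists (fun x => ex_minn (exb x)); split.
  by move=> x; case: ex_minnP => k /asboolP.
move=> k.
rewrite (_ : [set x | _] = A k `\` \bigcup_(i < k) A i).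
  by apply: measurableD => //; exact: bigcup_measurable.
apply/seteqP; split => x /=; case: ex_minnP => m /asboolP Am minm.
  move=> <-; split => // -[i /= im Ai].
  by have := minm i (asboolT Ai); rewrite leqNgt im.
move=> [Ak nA]; apply/eqP; rewrite eqn_leq minm/=; last exact/asboolP.
by rewrite leqNgt; apply/negP => mk; apply: nA; exists m.
Qed.

End first_index.

Section existence.
Context d (Omega : measurableType d) {R : realType} (P : probability Omega R).
Variable u : Omega -> L2T R.
Hypothesis uL4 : in_L4L2 P u.

Lemma cmeasurable_fourier_coef_data k : cmeasurable (fun w => fourier_coef (u w) k).
Proof.
have [mR mI] := @cmeasurable_fourier_coef R k.
by split; [exact: (measurable_L2_functional uL4 mR)|exact: (measurable_L2_functional uL4 mI)].
Qed.

Lemma measurable_energy_data N : measurable_fun [set: Omega] (fun w => energy (u w) N).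
Proof.
apply: measurable_fun_sum_real => j; apply: measurable_funX.
by apply: measurable_normc; exact: cmeasurable_fourier_coef_data.
Qed.

(** Monotone, and bounded by Bessel's inequality. *)
Lemma is_cvg_energy (f : L2T R) : cvgn (energy f).
Proof.
apply: nondecreasing_is_cvgn; first by move=> N M; exact: energy_nondecreasing.
exists (fine (sqr_mass f) / (2 * pi)) => _ [N _ <-].
have pi2 : 0 < 2 * pi :> R by rewrite mulr_gt0// pi_gt0.
have [mf foo] := L2T_square_integrable f.
rewrite ler_pdivlMr// mulrC -lee_fin fineK ?ge0_fin_numE ?sqr_mass_ge0//.
exact: energy_le.
Qed.

(** Taking the least admissible index makes the random subsequence measurable. It
    depends on the datum alone, because the energy does not change in time. *)
Lemma measurable_fast_index : exists idx : nat -> Omega -> nat,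
  (forall j w, `|limn (energy (u w)) - energy (u w) (idx j w)| <=
     2^-1 * (2 ^+ j)^-1 ^+ 2) /\
  (forall j k, measurable [set w | idx j w = k]).
Proof.
pose L w := limn (energy (u w)).
have mL : measurable_fun [set: Omega] L.
  apply: (measurable_fun_cvg measurable_energy_data) => w _.
  exact: (@is_cvg_energy (u w)).
have /choice[idx hidx] : forall j, exists idx : Omega -> nat,
    (forall w, `|L w - energy (u w) (idx w)| <= 2^-1 * (2 ^+ j)^-1 ^+ 2) /\
    (forall k, measurable [set w | idx w = k]).
  move=> j; set e : R := 2^-1 * _.
  have e0 : 0 < e by rewrite mulr_gt0// exprn_gt0// invr_gt0 exprn_gt0.
  apply: (measurable_first_index (A := fun k => [set w | `|L w - energy (u w) k| <= e])).
    move=> w; have := @is_cvg_energy (u w); move=> /cvgrPdist_le /(_ e e0)[k _ Hk].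
    by exists k; exact: (Hk k (leqnn k)).
  move=> k.
  have -> : [set w | `|L w - energy (u w) k| <= e] =
      (fun w => `|L w - energy (u w) k|) @^-1` `]-oo, e].
    by apply/seteqP; split => w /=; rewrite in_itv.
  rewrite -[X in measurable X]setTI.
  have m : measurable_fun [set: Omega] (fun w => `|L w - energy (u w) k|).
    apply: measurableT_comp => //.
    by apply: measurable_funB => //; exact: measurable_energy_data.
  by apply: m.
by exists idx; split=> j; case: (hidx j).
Qed.

Variable V : Omega * measurableTypeR R -> R.
Hypothesis mV : measurable_fun [set: (Omega * measurableTypeR R)%type] V.

Lemma cmeasurable_evolution_data N :
  @cmeasurable R _ (Omega * measurableTypeR R * measurableTypeR R)%type
    (fun q => evolution_partial_sum (V q.1) (u q.1.1) N q.2).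
Proof.
apply: cmeasurable_sum => j; apply: cmeasurableM.
  have [mR mI] := cmeasurable_fourier_coef_data (j%:Z - N%:Z).
  have m11 := measurableT_comp (measurable_fst : measurable_fun [set: (Omega * measurableTypeR R)%type] fst)
    (measurable_fst : measurable_fun [set: (Omega * measurableTypeR R * measurableTypeR R)%type] fst).
  by split; [exact: (measurableT_comp mR m11)|exact: (measurableT_comp mI m11)].
apply: cmeasurable_expi; apply: measurable_funD.
  exact: measurable_funM.
by apply: measurable_funM => //; exact: measurableT_comp.
Qed.

(** Sampled along the random subsequence, the truncations converge at almost every
    position; their pointwise limit is jointly measurable. *)
Lemma random_evolution_exists (W : R -> Omega -> R) (T : R) :
  {ae (P \x lebesgue_on 0 T)%E, forall p, V p = W p.2 p.1} ->
  exists v, is_random_evolution P W u T v.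
Proof.
move=> VW; have [idx [hidx midx]] := measurable_fast_index.
pose h j (q : Omega * measurableTypeR R * measurableTypeR R) :=
  evolution_partial_sum (V q.1) (u q.1.1) (idx j q.1.1) q.2.
exists (pointwise_limit h); split.
  apply: cmeasurable_pointwise_limit => j.
  apply: (@cmeasurable_index _ (Omega * measurableTypeR R * measurableTypeR R)%type _
    (fun k q => evolution_partial_sum (V q.1) (u q.1.1) k q.2) (fun q => idx j q.1.1)).
    exact: cmeasurable_evolution_data.
  move=> k.
  rewrite -[X in measurable X]setTI.
  exact: (measurableT_comp measurable_fst measurable_fst) (midx j k).
apply: filterS VW => p <-.
exact: (is_free_evolution_pointwise_limit (V p)
  (@is_cvg_energy (u p.1)) (fun j => hidx j p.1)).
Qed.

End existence.

Section brownian_version.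
Context d (Omega : measurableType d) {R : realType} (P : probability Omega R).

(** The exceptional pairs have their path in a null set or their time outside
    [[0, T]]; both sets are null for the product measure. *)
Lemma ae_brownian_version (V : Omega * measurableTypeR R -> R)
    (W : R -> Omega -> R) (A : set Omega) (T : R) :
  measurable A -> P A = 0 ->
  (forall w t, ~ A w -> 0 <= t -> V (w, t) = W t w) ->
  {ae (P \x lebesgue_on 0 T)%E, forall p, V p = W p.2 p.1}.
Proof.
move=> mA PA0 VW.
pose B1 : set (Omega * measurableTypeR R) := A `*` setT.
pose B2 : set (Omega * measurableTypeR R) := setT `*` ~` `[0, T].
have mI : measurable (~` `[0, T] : set (measurableTypeR R)).
  by apply: measurableC; exact: measurable_itv.
have N1 : (P \x lebesgue_on 0 T)%E.-negligible B1.
  exists B1; split => //; first exact: measurableX.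
  by rewrite product_measure1E// [X in (X * _)%E]PA0 mul0e.
have N2 : (P \x lebesgue_on 0 T)%E.-negligible B2.
  exists B2; split => //; first exact: measurableX.
  by rewrite product_measure1E// [X in (_ * X)%E]lebesgue_on_setC mule0.
apply: negligibleS (negligibleU N1 N2) => -[w t] /= nVW.
have [Aw|nAw] := pselect (A w); first by left.
right; split => //= /itvP t0; apply: nVW; apply: VW => //.
by rewrite t0.
Qed.

End brownian_version.

(** * The space-time estimate *)

Section spacetime.
Context d (Omega : measurableType d) {R : realType} (P : probability Omega R) (T : R).

(** The product measure under a name of its own, to carry the structure of a
    finite measure that Tonelli's theorem relies on. *)
Definition spacetime : set (Omega * measurableTypeR R)%type -> \bar R :=
  (P \x lebesgue_on 0 T)%E.

HB.instance Definition _ := Measure.on spacetime.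

Let spacetime_fin : fin_num_fun spacetime.
Proof.
apply: lty_fin_num_fun.
have E : spacetime setT = (P setT * lebesgue_on 0 T setT)%E.
  by rewrite -product_measure1E// setXTT.
rewrite [X in (X < _)%E]E lte_mul_pinfty//; last by rewrite -ge0_fin_numE// fin_num_measure.
exact: fin_num_measure.
Qed.

HB.instance Definition _ := Measure_isFinite.Build _ _ _ spacetime spacetime_fin.

Lemma tonelli_spacetime
    (F : Omega * measurableTypeR R * measurableTypeR R -> \bar R) :
  measurable_fun [set: (Omega * measurableTypeR R * measurableTypeR R)%type] F ->
  (forall q, 0 <= F q)%E ->
  (\int[((P \x lebesgue_on 0 T) \x lebesgue_on 0 (2 * pi))]_q F q =
   \int[(P \x lebesgue_on 0 T)]_p \int[torus_measure]_x F (p, x))%E.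
Proof.
move=> mF F0.
exact: (@fubini_tonelli1 _ _ _ _ R spacetime (lebesgue_on 0 (2 * pi)) F mF F0).
Qed.

Lemma measurable_integral_torus
    (F : Omega * measurableTypeR R * measurableTypeR R -> \bar R) :
  measurable_fun [set: (Omega * measurableTypeR R * measurableTypeR R)%type] F ->
  (forall q, 0 <= F q)%E ->
  measurable_fun [set: (Omega * measurableTypeR R)%type]
    (fun p => \int[torus_measure]_x F (p, x))%E.
Proof.
move=> mF F0.
exact: (@measurable_fun_fubini_tonelli_F _ _ _ _ R (lebesgue_on 0 (2 * pi)) F mF F0).
Qed.

End spacetime.

Section spacetime_bound.
Context d (Omega : measurableType d) {R : realType} (P : probability Omega R).
Local Notation mu := (@torus_measure R).
Variable u : Omega -> L2T R.
Hypothesis uL4 : in_L4L2 P u.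
Variable W : R -> Omega -> R.
Hypothesis BM : is_brownian P W.
Hypothesis indep : independent_sigma P (sigma_L2 u) (sigma_process W).

Lemma sqr_mass_cvg0 (g : nat -> measurableTypeR R -> R[i]%C) :
  L2norm (g N) @[N --> \oo] --> 0%E -> sqr_mass (g N) @[N --> \oo] --> 0%E.
Proof.
move=> /fine_cvgP[fin cv]; apply/fine_cvgP; split.
  apply: filterS fin => N fN.
  by rewrite sqr_massE ge0_fin_numE ?poweR_ge0// poweR_lty// ltey_eq fN.
have -> : fine \o (fun N => sqr_mass (g N)) = (fun N => fine (L2norm (g N)) * fine (L2norm (g N))).
  apply/funext => N /=; rewrite sqr_massE.
  have : (0 <= L2norm (g N))%E by exact: Lnorm_ge0.
  case: (L2norm (g N)) => [r| |] //=; last by rewrite gt_eqF ?mul0r.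
  by rewrite lee_fin => r0; rewrite powR_mulrn// expr2.
by rewrite -[X in _ --> X](mulr0 (0 : R)); exact: cvgM.
Qed.

(** Convergence of the series in [L^2] and lower semicontinuity. *)
Lemma free_evolution_quartic_mass_le (s : R) (f g : measurableTypeR R -> R[i]%C) :
  is_free_evolution s f g ->
  (\int[mu]_x (normc (g x) ^+ 4)%:E <=
   limn_einf (fun N => (quartic_phase f N s)%:E))%E.
Proof.
move=> [[_ mg _] cv].
under [X in limn_einf X]eq_fun do rewrite -quartic_mass_partial_sum.
apply: quartic_mass_lsc => //; last exact: sqr_mass_cvg0.
by move=> N; exact: cmeasurable_evolution_partial_sum.
Qed.

(** The bound on the truncations is uniform in [N], so that it survives the lower
    limit; Fatou's lemma exchanges this limit with the average over the paths
    and the times. *)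
Lemma integral_spacetime_pow4_le (T alpha : R)
    (v : Omega * measurableTypeR R * measurableTypeR R -> R[i]%C) :
  0 < T -> 2^-1 < alpha -> alpha <= 2 -> is_random_evolution P W u T v ->
  (\int[(P \x lebesgue_on 0 T) \x lebesgue_on 0 (2 * pi)]_q (normc (v q) ^+ 4)%:E <=
   (quartic_constant alpha * (T + T `^ (1 - alpha / 2)))%:E *
   \int[P]_w (data_norm u w ^+ 4)%:E)%E.
Proof.
move=> T0 a1 a2 [mv vE].
have [V [mV [A [mA PA0 VW]]]] := brownian_jointly_measurable BM.
have VWae := ae_brownian_version T mA PA0 VW.
have VWt t : 0 < t -> {ae P, forall w, V (w, t) = W t w}.
  move=> t0; exists A; split => // w nV; apply: contrapT => nA.
  by apply: nV; apply: VW => //; exact: ltW.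
pose F q := (normc (v q) ^+ 4)%:E.
have mF : measurable_fun [set: (Omega * measurableTypeR R * measurableTypeR R)%type] F.
  by apply/measurable_EFinP; apply: measurable_funX; exact: measurable_normc.
have F0 q : (0 <= F q)%E by rewrite lee_fin exprn_ge0// normc_ge0.
rewrite (tonelli_spacetime P T mF F0).
pose G N (p : Omega * measurableTypeR R) := (quartic_phase (u p.1) N (V p))%:E.
have mG N : measurable_fun [set: (Omega * measurableTypeR R)%type] (G N).
  by apply/measurable_EFinP; exact: (measurable_quartic_phase uL4 _ measurable_fst mV).
have G0 N p : (0 <= G N p)%E by rewrite lee_fin quartic_phase_ge0.
have mlim : measurable_fun [set: (Omega * measurableTypeR R)%type] (fun p => limn_einf (G ^~ p)).
  rewrite /limn_einf; apply: measurableT_comp => //.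
  by apply: measurable_fun_limn_esup => j; exact: measurableT_comp.
have lim0 p : (0 <= limn_einf (G ^~ p))%E by apply: limn_einf_ge; exact: nearW.
apply: (@le_trans _ _ (\int[P \x lebesgue_on 0 T]_p limn_einf (G ^~ p))%E).
  apply: ae_ge0_le_integral => //.
  - by move=> p _; apply: integral_ge0 => x _; exact: F0.
  - exact: (measurable_integral_torus mF F0).
  apply: (negligibleS _ (negligibleU vE VWae)) => p /= nle.
  apply: contrapT => /not_orP[/contrapT vp /contrapT Vp]; apply: nle => _.
  by rewrite /G Vp; exact: free_evolution_quartic_mass_le vp.
apply: (le_trans (fatou _ measurableT mG (fun N p _ => G0 N p))).
set B := (X in (_ <= X)%E).
have GB N : (\int[P \x lebesgue_on 0 T]_p G N p <= B)%E.
  exact: (integral_quartic_phase_le uL4 BM indep mV VWt).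
rewrite limn_einf_lim (cvg_lim _ (@cvg_einfs_sup _ _))//.
apply: ge_ereal_sup => _ [n _ <-].
by apply: le_trans (GB n); apply: ereal_inf_lbound; exists n => /=.
Qed.

Lemma L4_spacetime_norm_le (T alpha : R)
    (v : Omega * measurableTypeR R * measurableTypeR R -> R[i]%C) :
  0 < T -> 2^-1 < alpha -> alpha <= 2 -> is_random_evolution P W u T v ->
  (L4_spacetime_norm P T v <=
   (quartic_constant alpha `^ 4^-1 * (T + T `^ (1 - alpha / 2)) `^ 4^-1)%:E *
   L4L2norm P u)%E.
Proof.
move=> T0 a1 a2 vE.
have K0 := quartic_constant_ge0 a1.
have S0 : 0 <= T + T `^ (1 - alpha / 2) by rewrite addr_ge0 ?powR_ge0// ltW.
rewrite /L4_spacetime_norm (cLnorm_nat _ 4).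
have L0 : (0 <= L4L2norm P u)%E by exact: Lnorm_ge0.
have -> : L4L2norm P u = ((L4L2norm P u `^ 4) `^ 4^-1)%E.
  by rewrite -poweRrM divff// poweRe1.
rewrite -powRM// -poweR_EFin -poweRM//; last 2 first.
- by rewrite lee_fin mulr_ge0.
- exact: poweR_ge0.
apply: le_poweR => //.
  by apply: integral_ge0 => q _; rewrite lee_fin exprn_ge0// normc_ge0.
rewrite L4L2norm_pow4; exact: integral_spacetime_pow4_le.
Qed.

End spacetime_bound.

Theorem theorem5 (R : realType) (alpha : R)
    (alpha_gt : 2^-1 < alpha) (alpha_le : alpha <= 2) :
  exists C : R,
  forall (d : measure_display) (Omega : measurableType d)
    (P : probability Omega R) (W : R -> Omega -> R),
  is_brownian P W ->
  forall (T : R) (u0 : Omega -> L2T R),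
  0 < T ->
  in_L4L2 P u0 ->
  independent_sigma P (sigma_L2 u0) (sigma_process W) ->
  (exists v : Omega * measurableTypeR R * measurableTypeR R -> R[i],
     is_random_evolution P W u0 T v) /\
  (forall v : Omega * measurableTypeR R * measurableTypeR R -> R[i],
     is_random_evolution P W u0 T v ->
     (L4_spacetime_norm P T v <=
       (C * (T + T `^ (1 - alpha / 2)) `^ 4^-1)%:E * L4L2norm P u0)%E).
Proof.
exists (quartic_constant alpha `^ 4^-1) => d Omega P W BM T u0 T0 uL4 indep.
split; last by move=> v vE; exact: (L4_spacetime_norm_le uL4 BM indep T0 alpha_gt alpha_le vE).
have [V [mV [A [mA PA0 VW]]]] := brownian_jointly_measurable BM.
exact: (random_evolution_exists uL4 mV (ae_brownian_version T mA PA0 VW)).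
Qed.
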